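(* Connect each point $(x,y)$ of the even lattice $\{(x,y)\in\mathbb Z^2:x+y\equiv0\bmod2\}$ to either $(x-1,y-1)$ or $(x+1,y-1)$, each with probability $\frac12$, independently for different points, and let $\boldsymbol T$ be the resulting graph, rooted at $0$ (it is a.s. a one-ended tree and $[\boldsymbol T,0]$ is unimodular). Then, under the graph-distance metric, $$\mathrm{udim}_M(\boldsymbol T)=\mathrm{udim}_H(\boldsymbol T)=\tfrac32.$$
   Context: Discrete spaces. A discrete space is a metric space $(D,d)$ in which every ball of finite radius is finite (e.g. a connected locally finite graph with graph distance). A pointed discrete space $(D,o)$ has a distinguished point $o$ (origin or root); doubly-pointed ones have two. A marked discrete space carries a function $m:D\times D\to\Xi$ with $\Xi$ a complete separable metric space; $m(x):=m(x,x)$. Isomorphisms are isometries preserving origins and marks. $\mathcal D_*,\mathcal D_{**}$ (resp. $\mathcal D'_*,\mathcal D'_{**}$) are the sets of isomorphism classes of pointed and doubly-pointed discrete spaces (resp. marked ones), with classes in brackets, and the Borel $\sigma$-field of the following metric: $1\wedge$ the infimum of $\epsilon>0$ such that, in both directions, there is an injection from the closed ball of radius $1/\epsilon$ around the origin of one space into the other, preserving origins and changing distances and marks by at most $\epsilon$. A random element $[\boldsymbol D,\boldsymbol o]$ of $\mathcal D_*$ is unimodular if $\mathbb E[\sum_{v\in\boldsymbol D}g[\boldsymbol D,\boldsymbol o,v]]=\mathbb E[\sum_{v\in\boldsymbol D}g[\boldsymbol D,v,\boldsymbol o]]$ for all measurable $g:\mathcal D_{**}\to[0,\infty)$. Equivariant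 processes. An equivariant process with values in $\Xi$ assigns to every deterministic discrete space $D$ a random element $\boldsymbol Z_D$ of $\Xi^{D\times D}$ (extra randomness allowed) such that (i) for every isometry $\rho:D_1\to D_2$, $\boldsymbol Z_{D_1}\circ\rho^{-1}$ has the same distribution as $\boldsymbol Z_{D_2}$; (ii) for every measurable $A\subseteq\mathcal D'_*$, $[D,o]\mapsto\mathbb P[[D,o;\boldsymbol Z_D]\in A]$ is measurable. It suffices that it be defined for almost all realizations of $\boldsymbol D$. An equivariant subset is the set of points with mark 1 in a $\{0,1\}$-valued equivariant process; its intensity is $\mathbb P[\boldsymbol o\in\boldsymbol S_{\boldsymbol D}]$. Dimensions. $N_r(v)=\{u:d(u,v)\le r\}$ for $r\ge1$ and $N_0(v):=\emptyset$. An equivariant $r$-covering is an equivariant subset $\boldsymbol R$ such that the balls $N_r(v)$, $v\in\boldsymbol R_{\boldsymbol D}$, cover $\boldsymbol D$ a.s.; $\lambda_r$ is the infimum of their intensities; $\mathrm{udim}_M(\boldsymbol D):=\lim_{r\to\infty}\frac{-\log\lambda_r}{\log r}$ when the limit exists (the statement includes existence). An equivariant covering is an equivariant process $\boldsymbol R$ with values in $\{0\}\cup[1,\infty)$ on points such that the balls $N_{\boldsymbol R(v)}(v)$ cover $\boldsymbol D$ a.s.; $\mathcal H^\alpha_1(\boldsymbol D):=\inf_{\boldsymbol R}\mathbb E[\boldsymbol R(\boldsymbol o)^\alpha]$ over all of them ($0^0:=0$), and $\mathrm{udim}_H(\boldsymbol D):=\sup\{\alpha\ge0:\mathcal H^\alpha_1(\boldsymbol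 D)=0\}$, $\sup\emptyset:=0$. *)

(* Defs.v *)
From HB Require Import structures.
From mathcomp Require Import all_boot all_order all_algebra.
From mathcomp Require Import all_classical all_reals all_analysis.
From mathcomp Require Import measurable_realfun.

Set Implicit Arguments.
Unset Strict Implicit.
Unset Printing Implicit Defensive.

Import Order.TTheory GRing.Theory Num.Theory.
Import numFieldNormedType.Exports.

Local Open Scope classical_set_scope.
Local Open Scope ring_scope.

(** * Discrete spaces *)

(** The carrier is a bare type rather than a [metricType] so that sets of discrete
    spaces stay within the universe bounds of [set]. *)
Record dspace (R : realType) := DSpace {
  dcarrier :> Type ;
  dist : dcarrier -> dcarrier -> R ;
  distxx : forall x, dist x x = 0 ;
  dist_eq0 : forall x y, dist x y = 0 -> x = y ;
  dist_sym : forall x y, dist x y = dist y x ;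
  dist_triangle : forall y x z, dist x z <= dist x y + dist y z ;
  dist_finite : forall x r, finite_set [set y | dist x y <= r] }.

Record pspace (R : realType) := PSpace {
  pcarrier :> dspace R ;
  origin : pcarrier }.

Record mspace (R : realType) (Xi : metricType R) := MSpace {
  mcarrier :> pspace R ;
  mark : mcarrier -> mcarrier -> Xi }.

Definition eps_embeds (R : realType) (X Y : pspace R) (e : R) (f : X -> Y) :=
  let B := [set x : X | dist (origin X) x <= e^-1] in
  [/\ f (origin X) = origin Y,
      (forall x y, B x -> B y -> f x = f y -> x = y) &
      (forall x y, B x -> B y -> `|dist (f x) (f y) - dist x y| <= e)].

Definition pspace_dist (R : realType) (X Y : pspace R) : R :=
  Num.min 1 (inf [set e | 0 < e /\
    (exists f : X -> Y, eps_embeds e f) /\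
    (exists f : Y -> X, eps_embeds e f)]).

Definition eps_membeds (R : realType) (Xi : metricType R) (X Y : mspace Xi)
    (e : R) (f : X -> Y) :=
  eps_embeds e f /\
  forall x y : X, dist (origin X) x <= e^-1 -> dist (origin X) y <= e^-1 ->
    mdist (mark (f x) (f y)) (mark x y) <= e.

Definition mspace_dist (R : realType) (Xi : metricType R) (X Y : mspace Xi) :
    R :=
  Num.min 1 (inf [set e | 0 < e /\
    (exists f : X -> Y, eps_membeds e f) /\
    (exists f : Y -> X, eps_membeds e f)]).

(** Both distances are invariant under isomorphism, hence every set that is
    open for one of them, and every set of the generated sigma-field, is a union
    of isomorphism classes: the Borel sets of the space of isomorphism classes
    are exactly the images of the sets below, and [measurable_on_classes f]
    makes [f] a measurable function of the isomorphism class. *)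
Definition open_for (R : realType) (T : Type) (dT : T -> T -> R)
    (U : set T) :=
  forall x, U x -> exists2 e, 0 < e & forall y, dT x y < e -> U y.

Definition borel_for (R : realType) (T : Type) (dT : T -> T -> R) :
    set (set T) := <<s open_for dT >>.

Definition measurable_on_classes (R : realType) (f : pspace R -> \bar R) :=
  forall B : set (\bar R), measurable B ->
    borel_for (@pspace_dist R) (f @^-1` B).

(** * Equivariant processes *)

Definition marking_measurable (R : realType) (Xi : metricType R) (D : dspace R) :
    set (set (D -> D -> Xi)) :=
  <<s [set C | exists (x y : D) (U : set Xi), open U /\
                 C = [set m | U (m x y)]] >>.

(** [ep_sample D] carries the randomness of the process on [D], which is extra
    to that of [D] when [D] is itself random. *)
Record eprocess (R : realType) (Xi : metricType R) := EProcess {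
  ep_disp : dspace R -> measure_display ;
  ep_sample : forall D, measurableType (ep_disp D) ;
  ep_prob : forall D, probability (ep_sample D) R ;
  ep_val : forall D : dspace R, ep_sample D -> D -> D -> Xi ;
  ep_measurable : forall (D : dspace R) (E : set (D -> D -> Xi)),
    marking_measurable E -> measurable (@ep_val D @^-1` E) ;
  ep_equivariant : forall (D1 D2 : dspace R) (rho : D1 -> D2) (rhoV : D2 -> D1),
    cancel rho rhoV -> cancel rhoV rho ->
    (forall x y, dist (rho x) (rho y) = dist x y) ->
    forall E : set (D2 -> D2 -> Xi), marking_measurable E ->
      ep_prob D1 [set z | E (fun x y => ep_val z (rhoV x) (rhoV y))] =
      ep_prob D2 (@ep_val D2 @^-1` E) ;
  ep_kernel : forall A : set (mspace Xi), borel_for (@mspace_dist R Xi) A ->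
    measurable_on_classes (fun X : pspace R =>
      ep_prob X [set z | A (@MSpace R Xi X (ep_val z))]) }.

(** Subspaces of the real line as mark spaces; only the closed, hence complete
    and separable, subsets [marks01] and [radii] are used. *)
Definition marks_in (R : realType) (A : set R) : Type := {x : R | x \in A}.

Section MarksIn.
Context (R : realType) (A : set R).
Local Notation M := (marks_in A).
HB.instance Definition _ := Choice.on M.

Let d (x y : M) : R := `|val x - val y|.
Let dxx x : d x x = 0. Proof. by rewrite /d subrr normr0. Qed.
Let d_pos x y : d x y = 0 -> x = y.
Proof. by move/normr0_eq0/eqP; rewrite subr_eq0 => /eqP/val_inj. Qed.
Let d_sym x y : d x y = d y x. Proof. exact: distrC. Qed.
Let d_tri y x z : d x z <= d x y + d y z. Proof. exact: ler_distD. Qed.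
HB.instance Definition _ := isMetric.Build R M dxx d_pos d_sym d_tri.
End MarksIn.

Definition marks01 (R : realType) : metricType R := marks_in [set 0; 1 : R].

Definition radii (R : realType) : metricType R :=
  marks_in ([set 0 : R] `|` [set r : R | 1 <= r]).

Definition point_mark (R : realType) (A : set R) (P : eprocess (marks_in A))
    (D : dspace R) (z : ep_sample P D) (v : D) : R := val (ep_val z v v).

(** * Minkowski and Hausdorff dimensions

    A random pointed discrete space is a map [X : Omega -> pspace R] on a
    probability space [(Omega, P)]. An equivariant process on it is sampled by
    drawing [w] from [P] and then the process from [ep_prob _ (X w)]. *)

Definition N (R : realType) (D : dspace R) (r : R) (v : D) : set D :=
  [set u | r != 0 /\ dist u v <= r].

(** [P[o \in S_D]], computed by conditioning on [D]. *)
Definition intensity (R : realType) (d : measure_display)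
    (Omega : measurableType d) (P : probability Omega R)
    (X : Omega -> pspace R) (S : eprocess (marks01 R)) : \bar R :=
  (\int[P]_w ep_prob S (X w) [set z | point_mark z (origin (X w)) = 1%R])%E.

Definition equivariant_rcovering (R : realType) (d : measure_display)
    (Omega : measurableType d) (P : probability Omega R)
    (X : Omega -> pspace R) (r : R) (S : eprocess (marks01 R)) :=
  {ae P, forall w, {ae ep_prob S (X w), forall z,
    forall u : X w, exists2 v : X w, point_mark z v = 1 & N r v u}}.

Definition lambda (R : realType) (d : measure_display)
    (Omega : measurableType d) (P : probability Omega R)
    (X : Omega -> pspace R) (r : R) : \bar R :=
  ereal_inf [set i | exists S : eprocess (marks01 R),
    equivariant_rcovering P X r S /\ i = intensity P X S].

Definition is_udimM (R : realType) (d : measure_display)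
    (Omega : measurableType d) (P : probability Omega R)
    (X : Omega -> pspace R) (l : \bar R) :=
  ((- lne (lambda P X r) / (ln r)%:E)%E @[r --> +oo%R] --> l).

Definition equivariant_covering (R : realType) (d : measure_display)
    (Omega : measurableType d) (P : probability Omega R)
    (X : Omega -> pspace R) (C : eprocess (radii R)) :=
  {ae P, forall w, {ae ep_prob C (X w), forall z,
    forall u : X w, exists v : X w, N (point_mark z v) v u}}.

(** [0 `^ 0 = 1] in the library. *)
Definition rpow (R : realType) (x a : R) : R := if x == 0 then 0 else x `^ a.

Definition H1 (R : realType) (d : measure_display)
    (Omega : measurableType d) (P : probability Omega R)
    (X : Omega -> pspace R) (a : R) : \bar R :=
  ereal_inf [set i | exists C : eprocess (radii R),
    equivariant_covering P X C /\
    i = (\int[P]_w \int[ep_prob C (X w)]_z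
           (rpow (point_mark z (origin (X w))) a)%:E)%E].

(** The maximum with [0] encodes the convention that the supremum of the empty
    set is [0]; here [ereal_sup set0 = -oo]. *)
Definition udimH (R : realType) (d : measure_display)
    (Omega : measurableType d) (P : probability Omega R)
    (X : Omega -> pspace R) : \bar R :=
  maxe 0%E (ereal_sup [set a%:E | a in [set a : R | 0 <= a /\ H1 P X a = 0%E]]).

(** * Graphs as discrete spaces *)

Section Graph.
Context (V : Type) (e : rel V).

Definition walk_length (u v : V) (n : nat) :=
  exists p : seq V, [/\ path e u p, last u p = v & size p = n].

Definition graph_connected := forall u v, exists n, walk_length u v n.

Definition locally_finite := forall u, finite_set [set v | e u v].

Definition graph_dist (u v : V) : nat :=
  if pselect (exists n, `[< walk_length u v n >]) is left h then ex_minn h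
  else 0%N.

Definition discrete_graph :=
  [/\ symmetric e, locally_finite & graph_connected].

Lemma graph_distP u v : graph_connected -> walk_length u v (graph_dist u v).
Proof.
move=> c; rewrite /graph_dist; case: pselect => [h|[]].
  by case: ex_minnP => n /asboolP.
by have [n ?] := c u v; exists n; apply/asboolP.
Qed.

Lemma graph_dist_le u v n : walk_length u v n -> (graph_dist u v <= n)%N.
Proof.
move=> c; rewrite /graph_dist; case: pselect => // h.
by case: ex_minnP => m _; apply; apply/asboolP.
Qed.

Lemma walk_rev u v n : symmetric e -> walk_length u v n -> walk_length v u n.
Proof.
move=> se [p [pp lp sp]]; exists (rev (belast u p)); split.
- by rewrite -lp rev_path (eq_path (e' := e)).
- by case: p lp {pp sp} => //= a p _; rewrite rev_cons last_rcons.
- by rewrite size_rev size_belast.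
Qed.

Lemma walk_cat u v w m n :
  walk_length u v m -> walk_length v w n -> walk_length u w (m + n).
Proof.
move=> [p [pp lp sp]] [q [pq lq sq]]; exists (p ++ q).
by rewrite cat_path last_cat lp pp pq size_cat sp sq.
Qed.

Lemma walk_finite u n : locally_finite -> finite_set [set v | walk_length u v n].
Proof.
move=> lf; elim: n => [|n IH].
  apply: (sub_finite_set _ (finite_set1 u)) => v [p [_ <- /size0nil ->]] //.
have : finite_set (\bigcup_(v in [set v | walk_length u v n]) [set w | e v w]).
  by apply: bigcup_finite => // i _; exact: lf.
apply: sub_finite_set => w [p]; case/lastP: p => [[//]|p x].
rewrite rcons_path last_rcons size_rcons => -[/andP[pp ex] <- [sp]].
by exists (last u p) => //; exists p.
Qed.

End Graph.

(** The vertex set with the graph distance when [e] is a connected locally finite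
    graph; otherwise the graph distance is not a metric with finite balls, and
    the metric pulled back from the numbering [num] is used. *)
Section GraphSpace.
Context (R : realType) (V : Type) (e : rel V) (num : V -> nat)
  (num_inj : injective num).

Definition graph_metric (u v : V) : R :=
  if pselect (discrete_graph e) then (graph_dist e u v)%:R
  else `|(num u)%:R - (num v)%:R|.

Let dxx u : graph_metric u u = 0.
Proof.
rewrite /graph_metric; case: pselect => [?|?] /=; last by rewrite subrr normr0.
have : (graph_dist e u u <= 0)%N by apply: graph_dist_le; exists [::].
by rewrite leqn0 => /eqP ->.
Qed.

Let d_eq0 u v : graph_metric u v = 0 -> u = v.
Proof.
rewrite /graph_metric; case: pselect => [[_ _ c]|?] /=.
  move/eqP; rewrite pnatr_eq0 => /eqP h.
  have [p [_ lp]] := graph_distP u v c.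
  by rewrite h => /size0nil p0; rewrite -lp p0.
by move/normr0_eq0/eqP; rewrite subr_eq0 eqr_nat => /eqP/num_inj.
Qed.

Let d_sym u v : graph_metric u v = graph_metric v u.
Proof.
rewrite /graph_metric; case: pselect => [[s _ c]|?] /=; last exact: distrC.
congr (_%:R); apply/eqP; rewrite eqn_leq; apply/andP.
by split; apply: graph_dist_le; apply: walk_rev => //; exact: graph_distP.
Qed.

Let d_tri v u w : graph_metric u w <= graph_metric u v + graph_metric v w.
Proof.
rewrite /graph_metric; case: pselect => [[s _ c]|?] /=; last exact: ler_distD.
rewrite -natrD ler_nat; apply: graph_dist_le.
by apply: (@walk_cat _ _ _ v); exact: graph_distP.
Qed.

Let d_finite u r : finite_set [set v | graph_metric u v <= r].
Proof.
rewrite /graph_metric; case: pselect => [[s lf c]|?] /=.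
  have : finite_set
      (\bigcup_(n in `I_(Num.bound r)) [set v | walk_length e u v n]).
    by apply: bigcup_finite => // n _; exact: walk_finite.
  apply: sub_finite_set => v /= h; exists (graph_dist e u v).
    rewrite /= -(ltr_nat R); apply: (le_lt_trans h).
    rewrite ltNge; apply/negP => hb.
    have r0 : 0 <= r by exact: le_trans hb.
    by have := archi_boundP r0; rewrite ltNge hb.
  exact: graph_distP.
pose b := Num.bound (r + (num u)%:R).
apply: (@sub_finite_set _ _ (num @^-1` `I_b)); last first.
  by apply: finite_preimage => // x y _ _; exact: num_inj.
move=> v /= h; rewrite -(ltr_nat R); apply: le_lt_trans (archi_boundP _).
  by rewrite -lerBlDr (le_trans _ h)// distrC ler_norm.
by rewrite addr_ge0// (le_trans _ h).
Qed.

Definition graph_dspace : dspace R := DSpace dxx d_eq0 d_sym d_tri d_finite.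

End GraphSpace.

(** * The drainage network *)

Definition even_pt : Type := {p : int * int | (2%:Z %| p.1 + p.2)%Z}.

Definition even_pt0 : even_pt := exist _ (0, 0) isT.

(** [c u] says whether [u] is connected to its lower right neighbour. *)
Definition drains (c : even_pt -> bool) : rel even_pt := fun u v =>
  val v == ((val u).1 + (if c u then 1 else -1), (val u).2 - 1).

Definition drainage (c : even_pt -> bool) : rel even_pt := fun u v =>
  drains c u v || drains c v u.

(** The graph is almost surely connected, so the numbering used off that event
    plays no role. *)
Definition drainage_network (R : realType) (c : even_pt -> bool) : pspace R :=
  @PSpace R
    (graph_dspace R (drainage c) (pcan_inj (@pickleK even_pt))) even_pt0.

Definition mutually_independent (R : realType) (d : measure_display)
    (Omega : measurableType d) (P : probability Omega R) (I : eqType)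
    (c : I -> Omega -> bool) :=
  forall (s : seq I) (B : I -> set bool), uniq s ->
    P (\bigcap_(i in [set` s]) (c i @^-1` B i)) =
    (\prod_(i <- s) P (c i @^-1` B i))%E.

(* Main.v *)
Require Import Defs.
From HB Require Import structures.
From mathcomp Require Import all_boot all_order all_algebra.
From mathcomp Require Import all_classical all_reals all_analysis.
From mathcomp Require Import measurable_realfun.
From mathcomp Require Import zify ring lra.

Set Implicit Arguments.
Unset Strict Implicit.
Unset Printing Implicit Defensive.

Import Order.TTheory GRing.Theory Num.Theory.
Import numFieldNormedType.Exports.
Local Open Scope classical_set_scope.
Local Open Scope ring_scope.

(** Follow the edges downwards: this is a flow of coalescing simple random walks.
    The gap between two of them is a lazy walk absorbed at 0, and it survives n
    steps from a neighbouring position with probability of order n^(-1/2), by an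
    explicit binomial formula. By mass transport this also bounds the probability
    that the origin has a descendant n generations away.

    Lower bound on the dimensions: the points whose height (depth of the subtree
    of descendants) is at least n and congruent to j modulo n form a 3n-covering,
    and for a suitable j its intensity is at most n^(-1/2) / n. Heights are cut off
    at M = n^3, which makes membership depend on a bounded neighbourhood only;
    hence the selection is a Borel function of the space.

    Upper bound: the expected size of the ball of radius r around the origin is of
    order r^(3/2), so for a > 3/2 the set of points all of whose balls of radius
    2^k have at most K 2^(ka) points has positive intensity for K large. Every ball
    of radius r contains O(r^a) of these points, and the mass distribution
    principle bounds E[R(o)^a] from below for every equivariant covering R. *)

(* In a module, so that the canonical structures put on even_pt do not enter the
   elaboration of the theorem. *)
Module Drainage.

(** * The even lattice, the downward flow and the law of the coins *)

Section EvenLattice.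

(** A covering has to be an equivariant process on every discrete space, measurable for the local
    metric, whereas heights refer to the direction of the flow. So the selection is phrased by
    distances alone: one-endedness turns having a descendant [k] generations away into a property of
    geodesics ([midpoint]). Since distances in a graph are integers, almost isometries are exact on
    balls, which makes the selection depend measurably on the space.

    In the other direction, Markov's inequality controls one radius at a time, while a covering may
    use all radii. An exponent above 3/2 leaves a factor that is summable over dyadic radii, hence
    points that are good at all scales. Only good points receive mass, so a ball of radius r sends
    O(r^a) wherever it is centred. The order r^(3/2) itself comes from 2r+1 generations with
    O(r^(1/2)) expected points each. Mass transport comes from lattice translations, which carry the
    coins to those of an isometric network. Coverings of fixed and of variable radius are treated
    together through a function [rho] from marks to radii. *)

Definition addp (u v : even_pt) : even_pt.
Proof.
exists (val u + val v); abstract by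
  rewrite /= addrACA; apply: (rpredD (valP u) (valP v)).
Defined.

Definition oppp (u : even_pt) : even_pt.
Proof.
exists (- val u); abstract by rewrite /= -opprD rpredN; exact: (valP u).
Defined.

Fact addpA : associative addp.
Proof. by move=> u v w; apply: val_inj; rewrite /= addrA. Qed.
Fact addpC : commutative addp.
Proof. by move=> u v; apply: val_inj; rewrite /= addrC. Qed.
Fact add0p : left_id even_pt0 addp.
Proof. by move=> u; apply: val_inj; rewrite /= add0r. Qed.
Fact addNp : left_inverse even_pt0 oppp addp.
Proof. by move=> u; apply: val_inj; rewrite /= addNr. Qed.

HB.instance Definition _ := Countable.copy even_pt
  {p : int * int | (2%:Z %| p.1 + p.2)%Z}.
HB.instance Definition _ := GRing.isZmodule.Build even_pt addpA addpC add0p addNp.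

Definition px (u : even_pt) : int := (val u).1.
Definition lv (u : even_pt) : int := (val u).2.

Lemma pxD u v : px (u + v) = px u + px v. Proof. by []. Qed.
Lemma lvD u v : lv (u + v) = lv u + lv v. Proof. by []. Qed.

Lemma even_pt_eq u v : px u = px v -> lv u = lv v -> u = v.
Proof.
by rewrite /px /lv => h1 h2; apply: val_inj; case: (val u) (val v) h1 h2 => ? ? [? ?] /= -> ->.
Qed.

Lemma even_parity u : exists k : int, px u + lv u = 2 * k.
Proof.
by have /dvdzP[k hk] := valP u; exists k; rewrite /px /lv hk mulrC.
Qed.

Definition down_step (b : bool) : even_pt.
Proof. exists (if b then 1 else -1, -1); abstract by case: b. Defined.

Lemma px_step b : px (down_step b) = if b then 1 else -1.
Proof. by case: b. Qed.
Lemma lv_step b : lv (down_step b) = -1. Proof. by case: b. Qed.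

(** Neighbours on one level are two apart, so [k] counts sites along the level. *)
Definition hpt (k : int) : even_pt.
Proof. exists (k * 2, 0); abstract by apply/dvdzP; exists k; rewrite /= addr0. Defined.

Lemma px_hpt k : px (hpt k) = k * 2. Proof. by []. Qed.
Lemma lv_hpt k : lv (hpt k) = 0. Proof. by []. Qed.

End EvenLattice.

Definition conf := even_pt -> bool.

Definition drain (c : conf) (u : even_pt) : even_pt := u + down_step (c u).

Definition flow (c : conf) n u := iter n (drain c) u.
Arguments drain : simpl never.
Arguments flow : simpl never.

Lemma drainsE c u v : drains c u v = (v == drain c u).
Proof.
apply/eqP/eqP => [h|->]; last by rewrite /drain /=; case: (c u).
by apply: val_inj; rewrite h /drain /=; case: (c u).
Qed.

Lemma lv_drain c u : lv (drain c u) = lv u - 1.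
Proof. by rewrite /drain lvD lv_step. Qed.

Lemma px_drain c u : px (drain c u) = px u + (if c u then 1 else -1).
Proof. by rewrite /drain pxD px_step. Qed.

Lemma flowS c n u : flow c n.+1 u = drain c (flow c n u). Proof. by []. Qed.
Lemma flowSr c n u : flow c n.+1 u = flow c n (drain c u).
Proof. exact: iterSr. Qed.
Lemma flowD c m n u : flow c (m + n) u = flow c m (flow c n u).
Proof. exact: iterD. Qed.

Lemma lv_flow c n u : lv (flow c n u) = lv u - n%:Z.
Proof. by elim: n => [|n IH]; rewrite ?subr0// flowS lv_drain IH; lia. Qed.

Lemma px_flow c n u : `|px (flow c n u) - px u| <= n%:Z.
Proof.
elim: n => [|n IH]; first by rewrite /flow /= subrr normr0.
by rewrite flowS px_drain; case: ifP => _; lia.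
Qed.

Definition translate (a : even_pt) (c : conf) : conf := fun u => c (u + a).
Definition flip (s : even_pt) (c : conf) : conf := fun u => c u (+) (u == s).

Lemma flow_translate a c n u : flow (translate a c) n u = flow c n (u + a) - a.
Proof.
elim: n => [|n IH]; first by rewrite /flow /= addrK.
by rewrite !flowS IH /drain /translate subrK addrAC.
Qed.

Lemma flow_flip s c n u : (forall i, (i < n)%N -> flow c i u != s) ->
  flow (flip s c) n u = flow c n u.
Proof.
elim: n => [//|n IH] h; rewrite !flowS IH; last by move=> i hi; apply: h; lia.
by rewrite /drain /flip (negbTE (h _ (ltnSn n))) addbF.
Qed.

(** A flow line only descends, so it never reads a coin above its starting point. The independence
    used in the recursions below rests on this. *)
Lemma flow_flip_lv s c n u : lv u < lv s -> flow (flip s c) n u = flow c n u.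
Proof.
move=> h; apply: flow_flip => i _; apply/eqP => /(congr1 lv).
by rewrite lv_flow; lia.
Qed.

(* Sites listed several times are allowed: then the cylinder may be empty. *)
Definition cyl (s : seq (even_pt * bool)) : set conf :=
  [set c | all (fun q => c q.1 == q.2) s].

Definition cylinders : set (set conf) := range cyl.

Lemma cyl_setI : setI_closed cylinders.
Proof.
move=> _ _ [s _ <-] [t _ <-]; exists (s ++ t) => //.
by apply/seteqP; split => c; rewrite /cyl /= all_cat => /andP.
Qed.

HB.instance Definition _ := Pointed.copy conf (even_pt -> bool).

Notation mconf := (g_sigma_algebraType cylinders).

Lemma measurable_site u b : measurable ([set c | c u = b] : set mconf).
Proof.
apply: sub_sigma_algebra; exists [:: (u, b)] => //.
by apply/seteqP; split => c; rewrite /cyl /= andbT => /eqP.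
Qed.

Lemma measurable_exists d (T : measurableType d) (U : countType) (A : U -> set T) :
  (forall i, measurable (A i)) -> measurable [set t | exists i, A i t].
Proof.
move=> h; rewrite (_ : [set _ | _] = \bigcup_i A i).
  by apply: countable_bigcupT_measurable => //; exact: countableP.
by apply/seteqP; split => [t [i]|t [i _]] ?; exists i.
Qed.

Lemma measurable_forall d (T : measurableType d) (U : countType) (A : U -> set T) :
  (forall i, measurable (A i)) -> measurable [set t | forall i, A i t].
Proof.
move=> h; rewrite -[X in measurable X]setCK; apply: measurableC.
rewrite (_ : ~` _ = [set t | exists i, ~ A i t]); last first.
  by apply/seteqP; split => t /=; [move/existsNP|move=> [i hi] /(_ i)].
by apply: measurable_exists => i; exact: measurableC.
Qed.

Lemma measurable_prop d (T : measurableType d) (Q : Prop) :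
  measurable [set _ : T | Q].
Proof.
have [h|h] := pselect Q.
  by rewrite (_ : [set _ | _] = setT) //; apply/seteqP; split.
by rewrite (_ : [set _ | _] = set0) //; apply/seteqP; split.
Qed.

Lemma measurable_and d (T : measurableType d) (A B : T -> Prop) :
  measurable [set t | A t] -> measurable [set t | B t] ->
  measurable [set t | A t /\ B t].
Proof. exact: measurableI. Qed.

Lemma measurable_flow n u (Q : even_pt -> Prop) :
  measurable ([set c | Q (flow c n u)] : set mconf).
Proof.
elim: n u => [|n IH] u; first exact: (@measurable_prop _ mconf (Q u)).
rewrite (_ : [set _ | _] = [set c | exists b, c u = b /\ Q (flow c n (u + down_step b))]).
  by apply: measurable_exists => b; apply: measurable_and => //; exact: measurable_site.
apply/seteqP; split => c /=; rewrite flowSr /drain; first by exists (c u).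
by move=> [b [<-]].
Qed.

Lemma measurable_flow2 n u m v (Q : even_pt -> even_pt -> Prop) :
  measurable ([set c | Q (flow c n u) (flow c m v)] : set mconf).
Proof.
rewrite (_ : [set _ | _] = [set c | exists w, flow c n u = w /\ Q w (flow c m v)]).
  apply: measurable_exists => w; apply: measurable_and.
    exact: (measurable_flow n u (fun x => x = w)).
  exact: (measurable_flow m v (Q w)).
by apply/seteqP; split => c /=; [eexists|move=> [w [<-]]].
Qed.

Section Law.
Context (R : realType) (d : measure_display) (Omega : measurableType d)
  (P : probability Omega R).

(** A predicate on families of coins: translating or flipping a fair family gives another fair
    family, and [law_unique] turns this into invariance of a single law. *)
Definition fair_coins (coin : even_pt -> Omega -> bool) :=
  [/\ forall u, measurable_fun setT (coin u),
      forall u, P [set w | coin u w = true] = (2^-1)%:E &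
      mutually_independent P coin].

Definition sample (coin : even_pt -> Omega -> bool) (w : Omega) : mconf :=
  fun u => coin u w.

Lemma sample_measurable coin : (forall u, measurable_fun setT (coin u)) ->
  measurable_fun setT (sample coin).
Proof.
move=> mc; apply: (@measurability _ _ Omega mconf _ _ cylinders) => // _ [_ [s _ <-] <-].
rewrite setTI; elim: s => [|[u b] s IH].
  by rewrite (_ : _ @^-1` _ = setT) //; apply/seteqP; split.
rewrite (_ : _ @^-1` _ =
  (coin u @^-1` [set b]) `&` (sample coin @^-1` cyl s)); last first.
  by apply/seteqP; split=> w; rewrite /sample /cyl /=; [move/andP => [/eqP]|move=> [/eqP ? ?]; apply/andP].
by apply: measurableI => //; rewrite -[X in measurable X]setTI; exact: mc.
Qed.

Lemma fair_coins_preim coin u (B : set bool) : fair_coins coin ->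
  P (coin u @^-1` B) = ((\1_B true + \1_B false) / 2)%:E.
Proof.
move=> [mc fc _].
have mt b : measurable (coin u @^-1` [set b]).
  by rewrite -[X in measurable X]setTI; exact: mc.
have ht : P (coin u @^-1` [set true]) = (2^-1)%:E by exact: fc.
have hf : P (coin u @^-1` [set false]) = (2^-1)%:E.
  rewrite (_ : _ @^-1` _ = ~` (coin u @^-1` [set true])); last first.
    by apply/seteqP; split=> w /=; case: (coin u w).
  by rewrite probability_setC // ht -EFinB; congr (_%:E); lra.
rewrite !indicE.
have [bt|bt] := pselect (B true); have [bf|bf] := pselect (B false).
- rewrite (_ : _ @^-1` _ = setT); last by apply/seteqP; split=> w //= _; case: (coin u w).
  by rewrite probability_setT !mem_set//=; congr (_%:E); lra.
- rewrite (_ : _ @^-1` _ = coin u @^-1` [set true]); last first.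
    by apply/seteqP; split=> w /=; case: (coin u w).
  by rewrite ht mem_set// memNset//=; congr (_%:E); lra.
- rewrite (_ : _ @^-1` _ = coin u @^-1` [set false]); last first.
    by apply/seteqP; split=> w /=; case: (coin u w).
  by rewrite hf memNset// mem_set//=; congr (_%:E); lra.
- rewrite (_ : _ @^-1` _ = set0); last by apply/seteqP; split=> w //=; case: (coin u w).
  by rewrite measure0 !memNset//=; congr (_%:E); lra.
Qed.

Lemma fair_coins_cyl coin coin' s : fair_coins coin -> fair_coins coin' ->
  P (sample coin @^-1` cyl s) = P (sample coin' @^-1` cyl s).
Proof.
move=> fc fc'.
(* At a listed site, [B u] intersects all requirements of the list: a singleton, or empty if they
   conflict. This reduces repeated sites to distinct ones, for which independence is available. *)
pose B u : set bool := [set b | forall b', (u, b') \in s -> b = b'].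
have E c : sample c @^-1` cyl s =
    \bigcap_(u in [set` undup (unzip1 s)]) (c u @^-1` B u).
  apply/seteqP; split=> w; rewrite /sample /cyl /=.
    by move/allP => h u _ b /h /eqP.
  move=> h; apply/allP => -[u b] us; apply/eqP; apply: h => //=.
  by rewrite mem_undup; apply/mapP; exists (u, b).
case: (fc) => _ _ ic; case: (fc') => _ _ ic'.
rewrite !E ic ?ic' ?undup_uniq//; apply: eq_bigr => u _.
by rewrite !fair_coins_preim.
Qed.

Lemma law_unique coin coin' (A : set mconf) : fair_coins coin -> fair_coins coin' ->
  measurable A -> P (sample coin @^-1` A) = P (sample coin' @^-1` A).
Proof.
move=> fc fc' mA.
have mc : measurable_fun setT (sample coin).
  by apply: sample_measurable; case: fc.
have mc' : measurable_fun setT (sample coin').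
  by apply: sample_measurable; case: fc'.
pose X : {mfun Omega >-> mconf} := HB.pack (sample coin) (isMeasurableFun.Build _ _ _ _ _ mc).
pose X' : {mfun Omega >-> mconf} := HB.pack (sample coin') (isMeasurableFun.Build _ _ _ _ _ mc').
have := @measure_unique _ R mconf cylinders (fun=> setT) erefl cyl_setI _ _
  (distribution P X) (distribution P X'); apply => //.
- by move=> _; exists [::] => //; apply/seteqP; split.
- by rewrite bigcup_const//; exists 0%N.
- by move=> _ [s _ <-]; exact: fair_coins_cyl.
- by move=> _; apply: (le_lt_trans (probability_le1 (distribution P X) _)) (ltry _).
Qed.

Lemma fair_coins_translate coin a : fair_coins coin ->
  fair_coins (fun u w => coin (u + a) w).
Proof.
move=> [mc fc ic]; split=> // s B us.
have := ic (map (+%R^~ a) s) (fun u => B (u - a)).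
rewrite map_inj_uniq; last exact: addIr.
move=> /(_ us); rewrite big_map.
under [in RHS]eq_bigr do rewrite addrK.
move=> <-; congr (P _); apply/seteqP; split=> w h u /=.
  by move/mapP => [v vs ->]; rewrite addrK; exact: h.
by move=> us'; have := h (u + a); rewrite /= addrK; apply; exact: map_f.
Qed.

Lemma fair_coins_flip coin v : fair_coins coin ->
  fair_coins (fun u w => coin u w (+) (u == v)).
Proof.
move=> fc; have [mc _ ic] := fc.
have E u (B : set bool) : (fun w => coin u w (+) (u == v)) @^-1` B =
    coin u @^-1` [set b | B (b (+) (u == v))] by [].
split=> [u|u|s B us].
- move=> _ B _; rewrite setTI E -[X in measurable X]setTI.
  by apply: mc.
- rewrite -[X in P X]/((fun w => coin u w (+) (u == v)) @^-1` [set true]) E.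
  rewrite fair_coins_preim//; case: (u == v); rewrite !indicE /=.
    by rewrite memNset//= mem_set//=; congr (_%:E); lra.
  by rewrite mem_set//= memNset//=; congr (_%:E); lra.
- under eq_bigcapr do rewrite E.
  by rewrite ic.
Qed.

End Law.

(** * Mass transport and the survival probabilities *)

Section EsumCount.
Context (R : realType) (T : countType).
Local Open Scope ereal_scope.

(** Brings sums over a countable type to series over [nat], where monotone convergence applies;
    integers that code no element contribute 0. *)
Lemma esum_nneseries (a : T -> \bar R) : (forall v, 0 <= a v) ->
  \esum_(v in setT) a v = \sum_(n <oo) oapp a 0 (pickle_inv n).
Proof.
move=> a0; rewrite nneseries_esumT; last by move=> n; case: pickle_inv => /=.
transitivity (\esum_(i in [set: nat]) if i \in pickle @` [set: T]
    then oapp a 0 (pickle_inv i) else 0); last first.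
  apply: eq_esum => n _; case: ifPn => // /negP; rewrite inE.
  case E : (pickle_inv n) => [v|]//= [].
  by exists v => //; have := @pickle_invK T n; rewrite E.
rewrite -esum_mkcond esum_image.
  by apply: eq_esum => v _; rewrite pickleK_inv.
by move=> u v _ _; exact: (pcan_inj pickleK).
Qed.

Lemma integral_esum d (X : measurableType d) (mu : {measure set X -> \bar R})
    (f : T -> X -> \bar R) :
  (forall v, measurable_fun setT (f v)) -> (forall v x, 0 <= f v x) ->
  \int[mu]_x (\esum_(v in setT) f v x) = \esum_(v in setT) \int[mu]_x f v x.
Proof.
move=> mf f0; rewrite esum_nneseries; last by move=> v; exact: integral_ge0.
under eq_integral do rewrite esum_nneseries//.
rewrite integral_nneseries//; last 2 first.
- by move=> n; case: pickle_inv => [v|] /=; [exact: mf|exact: measurable_cst].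
- by move=> n x _; case: pickle_inv => /=.
by apply: eq_eseriesr => n _; case: pickle_inv => //=; rewrite integral0.
Qed.

Lemma measurable_esum d (X : measurableType d) (f : T -> X -> \bar R) :
  (forall v, measurable_fun setT (f v)) -> (forall v x, 0 <= f v x) ->
  measurable_fun setT (fun x => \esum_(v in setT) f v x).
Proof.
move=> mf f0; under eq_fun do rewrite esum_nneseries//.
apply: ge0_emeasurable_sum => [n x _|n _].
  by case: pickle_inv => /=.
by case: pickle_inv => [v|] /=; [exact: mf|exact: measurable_cst].
Qed.

End EsumCount.

Lemma measurable_conf_map d (T : measurableType d) (g : T -> mconf) :
  (forall u b, measurable [set t | g t u = b]) -> measurable_fun setT g.
Proof.
move=> mg; apply: (@measurability _ _ T mconf _ _ cylinders) => // _ [_ [s _ <-] <-].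
rewrite setTI; elim: s => [|[u b] s IH].
  by rewrite (_ : _ @^-1` _ = setT) //; apply/seteqP; split.
rewrite (_ : _ @^-1` _ = [set t | g t u = b] `&` (g @^-1` cyl s)); last first.
  by apply/seteqP; split=> w; rewrite /cyl /=; [move/andP => [/eqP]|move=> [/eqP ? ?]; apply/andP].
exact: measurableI.
Qed.

Lemma measurable_translate a : measurable_fun setT (translate a : mconf -> mconf).
Proof. by apply: measurable_conf_map => u b; exact: measurable_site. Qed.

Section FairLaw.
Context (R : realType) (mu : probability mconf R).

(** The estimates see the coins through these two invariances: translations give mass transport, and
    flips express that each coin is fair and independent of the others. *)
Definition fair_law :=
  (forall a (A : set mconf), measurable A -> mu (translate a @^-1` A) = mu A) /\
  (forall s (A : set mconf), measurable A -> mu (flip s @^-1` A) = mu A).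

Hypothesis fl : fair_law.

Lemma integral_translate a (f : mconf -> \bar R) : measurable_fun setT f ->
  (forall c, 0 <= f c)%E ->
  (\int[mu]_c f (translate a c) = \int[mu]_c f c)%E.
Proof.
move=> mf f0; have mt := measurable_translate a.
rewrite -[LHS](@ge0_integral_pushforward _ _ _ _ R _ mt mu setT f)//.
by apply: eq_measure_integral => A mA _; exact: fl.1.
Qed.

(* f c u v is the mass sent from u to v. *)
Lemma mass_transport (f : mconf -> even_pt -> even_pt -> \bar R) :
  (forall u v, measurable_fun setT (fun c => f c u v)) ->
  (forall c u v, 0 <= f c u v)%E ->
  (forall a c u v, f (translate a c) u v = f c (u + a) (v + a)) ->
  (\esum_(v in setT) \int[mu]_c f c 0%R v = \esum_(v in setT) \int[mu]_c f c v 0%R)%E.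
Proof.
move=> mf f0 ft.
rewrite [RHS](reindex_esum setT setT (fun v : even_pt => - v)); last first.
  split=> [//|u v _ _|u _]; first exact: oppr_inj.
  by exists (- u); rewrite ?opprK.
apply: eq_esum => v _.
rewrite -(integral_translate (- v) (mf 0 v))//.
by apply: eq_integral => c _; rewrite ft add0r subrr.
Qed.

Lemma measure_split (A B : set mconf) : measurable A -> measurable B ->
  mu A = (mu (A `&` B) + mu (A `\` B))%E.
Proof. by move=> mA mB; rewrite addeC -measureDI. Qed.

(** The flip at [u] preserves [E] and exchanges its two parts according to the value of [c u], which
    therefore have equal measure. Writing a sum avoids a division in [\bar R]. *)
Lemma site_half u (E : set mconf) b : measurable E ->
  (forall c, E (flip u c) <-> E c) ->
  mu E = (mu ([set c | c u = b] `&` E) + mu ([set c | c u = b] `&` E))%E.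
Proof.
move=> mE Ef; have ms : measurable [set c : mconf | c u = b] by exact: measurable_site.
rewrite (measure_split mE ms) setIC; congr (_ + _)%E.
rewrite -[RHS](fl.2 u); last exact: measurableI.
congr (mu _); apply/seteqP; split => c /=.
  move=> [Ec hc]; split; last exact/Ef.
  by move: hc; rewrite /flip eqxx; case: (c u) (b) => -[].
move=> [hc /Ef Ec]; split=> // hc'; move: hc; rewrite /flip eqxx hc'.
by case: (b).
Qed.

(** This is conditioning on the coin at [u]; it yields both the recursion of the gap walk and the
    one for [meet_count]. *)
Lemma site_average u (E : bool -> set mconf) (x y : R) :
  (forall b, measurable (E b)) -> (forall b c, E b (flip u c) <-> E b c) ->
  mu (E true) = x%:E -> mu (E false) = y%:E ->
  mu [set c | E (c u) c] = ((x + y) / 2)%:E.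
Proof.
move=> mE Ef hx hy.
have ms b : measurable [set c : mconf | c u = b] by exact: measurable_site.
have H b z : mu (E b) = z%:E -> mu ([set c | c u = b] `&` E b) = (z / 2)%:E.
  have := site_half b (mE b) (Ef b).
  have : mu ([set c | c u = b] `&` E b) \is a fin_num.
    by apply: fin_num_measure; exact: measurableI.
  case: (mu (_ `&` _)) => // r _ -> [<-]; congr (_%:E); lra.
rewrite (_ : [set _ | _] = ([set c | c u = true] `&` E true) `|`
                           ([set c | c u = false] `&` E false)); last first.
  apply/seteqP; split => c /=; first by case: (c u) => ?; [left|right].
  by move=> [] [->].
rewrite measureU//.
- have H1 := H _ _ hx; have H2 := H _ _ hy.
  by rewrite [X in (X + _)%E]H1 [X in (_ + X)%E]H2 -EFinD; congr (_%:E); lra.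
- exact: measurableI.
- exact: measurableI.
- by apply/seteqP; split => c //= [[-> _] []].
Qed.

(** Probability that the gap walk, with steps 1, 0, -1 of probabilities 1/4, 1/2, 1/4, started at
    [k], avoids 0 for [i] steps. Each step is made of two fair half-steps, and the reflection
    principle gives the sum of the binomials (2i choose i+m) over -k < m <= k, divided by 4^i.
    Pairing m = -l with m = l+1 by Pascal's rule leaves the terms below. *)
Definition survival (i k : nat) : R :=
  \sum_(l < k) 'C(i.*2.+1, (i + l).+1)%:R / 4 ^+ i.

Lemma survival0 i : survival i 0 = 0. Proof. by rewrite /survival big_ord0. Qed.

Lemma survivalS i k : survival i k.+1 =
  survival i k + 'C(i.*2.+1, (i + k).+1)%:R / 4 ^+ i.
Proof. by rewrite /survival big_ord_recr. Qed.

Lemma survival_rec i k : survival i.+1 k.+1 =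
  (survival i k + survival i k.+1 *+ 2 + survival i k.+2) / 4.
Proof.
have e n : 4 ^+ n != 0 :> R by rewrite expf_neq0// pnatr_eq0.
have p4 : 4 ^+ i.+1 = 4 * 4 ^+ i :> R by rewrite exprS.
elim: k => [|k IH].
  rewrite !survivalS !survival0 !addn0 !add0r doubleS addn1.
  rewrite binS [in 'C(_, i.+1)]binS [in 'C(_, i.+2)]binS.
  (* Absorption at 0 enters here: the outer term left by Pascal's rule equals the central one by
     symmetry. *)
  have -> : 'C(i.*2.+1, i) = 'C(i.*2.+1, i.+1).
    by rewrite -bin_sub; [congr 'C(_, _)|]; lia.
  by rewrite !natrD p4; field.
have -> : survival i.+1 k.+2 = survival i.+1 k.+1 +
    ('C(i.*2.+1, (i + k).+3) + ('C(i.*2.+1, (i + k).+2) + 'C(i.*2.+1, (i + k).+2)) +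
     'C(i.*2.+1, (i + k).+1))%N%:R / 4 ^+ i.+1.
  rewrite survivalS doubleS addnS addSn; congr (_ + _%:R / _).
  by rewrite binS [in 'C(_, (i + k).+3)]binS [in X in (_ + X)%N]binS; lia.
rewrite IH (survivalS i k.+2) (survivalS i k.+1) (survivalS i k) !addnS.
move: 'C(_, _) 'C(_, _) 'C(_, _) => x y z.
by rewrite !natrD p4; field.
Qed.

(** The gap between the two flow lines, counted in sites, is the walk behind [survival]. While they
    are apart, their next coins sit at distinct sites of one level and are not read further down;
    averaging over them in turn is [survival_rec]. *)
Lemma mu_not_merged i k u v : lv u = lv v -> px v = px u + k%:Z *+ 2 ->
  mu [set c | flow c i u <> flow c i v] = (survival i k)%:E.
Proof.
elim: i k u v => [|i IH] k u v huv hk.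
  rewrite /survival; have [k0|k0] := posnP k.
    rewrite k0 big_ord0 (_ : [set _ | _] = set0) ?measure0//.
    apply/seteqP; split => c //; rewrite /flow /=; apply.
    by apply: even_pt_eq => //; rewrite hk k0 addr0.
  case: k hk k0 => // k hk _.
  rewrite big_ord_recl /= expr0 addn0 bin1 divr1 big1 => [|l _]; last first.
    by rewrite bin_small ?mul0r//= /bump; lia.
  rewrite addr0 (_ : [set _ | _] = setT) ?probability_setT//.
  by apply/seteqP; split => c // _ /= /(congr1 px); rewrite /flow /= hk; lia.
case: k hk => [|k] hk.
  rewrite survival0 (_ : [set _ | _] = set0) ?measure0//.
  apply/seteqP; split => c //; apply.
  by congr flow; apply: even_pt_eq => //; rewrite hk addr0.
have uv : (v == u) = false.
  by apply/eqP => /(congr1 px); rewrite hk; lia.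
pose E a b := [set c : mconf | flow c i (u + down_step a) <> flow c i (v + down_step b)].
have mE a b : measurable (E a b).
  exact: (measurable_flow2 i _ i _ (fun x y => x <> y)).
have H a b : mu (E a b) = (survival i (if a then (if b then k.+1 else k)
                                 else (if b then k.+2 else k.+1)))%:E.
  by apply: IH; rewrite ?lvD ?lv_step ?huv// !pxD !px_step hk; case: a b => -[]; lia.
have Ef a b w c : lv w = lv u -> E a b (flip w c) <-> E a b c.
  by move=> hw; rewrite /E /= !flow_flip_lv// lvD lv_step; lia.
pose F a := [set c : mconf | flow c i (u + down_step a) <> flow c i (drain c v)].
have HF a : mu (F a) = ((survival i (if a then k.+1 else k.+2) +
                        survival i (if a then k else k.+1)) / 2)%:E.
  apply: (@site_average v (E a)) => //.
  by move=> b c; apply: Ef.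
rewrite (_ : [set _ | _] = [set c | F (c u) c]); last first.
  by apply/seteqP; split => c; rewrite /F /= !flowSr.
rewrite (@site_average u F _ _ _ _ (HF true) (HF false)).
- by rewrite survival_rec; congr (_%:E); field.
- move=> a.
  have -> : F a = [set c : mconf | exists b, c v = b /\ E a b c].
    by apply/seteqP; split => c /=; [eexists|move=> [b [<-]]].
  apply: measurable_exists => b.
  exact: (measurableI _ _ (measurable_site v b) (mE a b)).
- move=> a c; have : E a (c v) (flip u c) <-> E a (c v) c by exact: Ef.
  by rewrite /F /E /= /drain /flip uv addbF.
Qed.

(** The left side is 3 at [i = 0] and does not increase: from [i] to [i + 1] the survival
    probability is multiplied by (2i+3)/(2i+4), and (2i+3)(2i+5) <= (2i+4)^2. *)
Lemma survival1_sqr i : (survival i 1) ^+ 2 * (i.*2 + 3)%:R <= 3.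
Proof.
rewrite survivalS survival0 add0r addn0.
elim: i => [|i IH]; first by rewrite bin1 expr0 divr1 expr1n mul1r.
have e : 4 ^+ i != 0 :> R by rewrite expf_neq0// pnatr_eq0.
have H : 'C(i.+1.*2.+1, i.+2)%:R * (i.+2)%:R = 2 * (i.*2 + 3)%:R * 'C(i.*2.+1, i.+1)%:R :> R.
  have H1 := mul_bin_diag i.*2.+3 i.+1.
  have H3 : 'C(i.*2.+1, i) = 'C(i.*2.+1, i.+1).
    by rewrite -bin_sub; [congr 'C(_, _)|]; lia.
  have H4 : 'C(i.*2.+2, i.+1) = (2 * 'C(i.*2.+1, i.+1))%N.
    by rewrite binS H3; lia.
  by rewrite -!natrM; congr (_%:R); rewrite doubleS; move: H1; rewrite /= H4; lia.
set x := 'C(i.*2.+1, i.+1)%:R in IH H *.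
have -> : 'C(i.+1.*2.+1, i.+2)%:R = 2 * (i.*2 + 3)%:R * x / i.+2%:R :> R.
  by rewrite -H mulfK// pnatr_eq0.
rewrite [4 ^+ i.+1]exprS; set z := 4 ^+ i in e IH *; set y := x / z in IH.
have -> : 2 * (i.*2 + 3)%:R * x / i.+2%:R / (4 * z) = (i.*2 + 3)%:R / (2 * i.+2%:R) * y.
  by rewrite /y; field; rewrite e -natrD pnatr_eq0.
have -> : (i.*2 + 3)%:R = 2 * i%:R + 3 :> R by rewrite natrD -mul2n natrM.
have -> : (i.+1.*2 + 3)%:R = 2 * i%:R + 5 :> R.
  by rewrite natrD -mul2n natrM -natr1; ring.
have hi : 0 <= i%:R :> R by [].
rewrite -[i.+2%:R]natr1 -[i.+1%:R]natr1; move: IH.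
have -> : (i.*2 + 3)%:R = 2 * i%:R + 3 :> R by rewrite natrD -mul2n natrM.
set t := i%:R in hi *; move=> IH.
have -> : ((2 * t + 3) / (2 * (t + 1 + 1)) * y) ^+ 2 * (2 * t + 5) =
  (y ^+ 2 * (2 * t + 3)) * ((2 * t + 3) * (2 * t + 5) / (2 * (t + 2)) ^+ 2).
  by field; lra.
apply: le_trans IH; rewrite ler_piMr//; first by rewrite mulr_ge0 ?sqr_ge0//; lra.
rewrite ler_pdivrMr ?mul1r; nra.
Qed.

Lemma survival_ge0 i k : 0 <= survival i k.
Proof. by apply: sumr_ge0 => l _; rewrite mulr_ge0// invr_ge0 exprn_ge0. Qed.

Lemma survival1_le i : survival i 1 <= 2 / Num.sqrt i.+1%:R.
Proof.
have s0 : 0 < Num.sqrt i.+1%:R :> R by rewrite sqrtr_gt0.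
rewrite ler_pdivlMr// -(@ler_pXn2r _ 2)// ?nnegrE ?mulr_ge0 ?survival_ge0 ?ltW//.
rewrite exprMn sqr_sqrtr//; have := survival1_sqr i.
have -> : (i.*2 + 3)%:R = 2 * i.+1%:R + 1 :> R.
  by rewrite -natr1 natrD -mul2n natrM; ring.
have : 0 <= survival i 1 ^+ 2 by exact: sqr_ge0.
by set a := survival i 1 ^+ 2; set b := i.+1%:R; nra.
Qed.

End FairLaw.

Section EsumIndic.
Context (R : realType) (T : countType) (d : measure_display)
  (X : measurableType d) (mu : {measure set X -> \bar R}) (A : T -> set X).
Local Open Scope ereal_scope.

Lemma esum_indic_ge x : (exists v, A v x) ->
  1 <= \esum_(v in setT) (\1_(A v) x)%:E :> \bar R.
Proof.
move=> [v Av]; apply: esum_ge; exists [set v]; first by split.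
by rewrite fsbig_set1 indicE mem_set.
Qed.

Lemma esum_indic_le x : (forall u v, A u x -> A v x -> u = v) ->
  \esum_(v in setT) (\1_(A v) x)%:E <= 1 :> \bar R.
Proof.
move=> h; have [[v Av]|no] := pselect (exists v, A v x); last first.
  by rewrite esum1 ?lee01// => v _; rewrite indicE memNset// => Av; apply: no; exists v.
have <- : \esum_(u in [set v]) (\1_(A u) x)%:E = 1 :> \bar R.
  by rewrite esum_set1 indicE ?mem_set// lee_fin.
rewrite [X in _ <= X]esum_mkcond; apply: le_esum => u _.
case: ifPn => //; rewrite notin_setE/= => uv.
by rewrite indicE memNset// => Au; apply: uv; exact: h.
Qed.

Hypothesis mA : forall v, measurable (A v).

Lemma esum_measureE :
  \esum_(v in setT) mu (A v) = \int[mu]_x \esum_(v in setT) (\1_(A v) x)%:E.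
Proof.
rewrite integral_esum => [|v|v x].
- by apply: eq_esum => v _; rewrite integral_indic// setIT.
- by apply/measurable_EFinP; exact: measurable_indic.
- by rewrite lee_fin.
Qed.

Let mesum : measurable_fun setT (fun x => \esum_(v in setT) (\1_(A v) x)%:E : \bar R).
Proof.
apply: measurable_esum => [v|v x]; last by rewrite lee_fin.
by apply/measurable_EFinP; exact: measurable_indic.
Qed.

Lemma measure_exists_le (E : set X) : measurable E ->
  (forall x, E x -> exists v, A v x) -> mu E <= \esum_(v in setT) mu (A v).
Proof.
move=> mE EA; rewrite esum_measureE.
have <- : \int[mu]_x (\1_E x)%:E = mu E by rewrite integral_indic// setIT.
apply: ge0_le_integral => //.
  by apply/measurable_EFinP; exact: measurable_indic.
move=> x _; rewrite indicE; have [/set_mem/EA/esum_indic_ge//|_] := boolP (x \in E).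
by apply: esum_ge0 => v _; rewrite lee_fin.
Qed.

Lemma esum_disjoint_le (E : set X) : measurable E ->
  (forall x v, A v x -> E x) ->
  (forall x u v, A u x -> A v x -> u = v) ->
  \esum_(v in setT) mu (A v) <= mu E.
Proof.
move=> mE AE h; rewrite esum_measureE.
have <- : \int[mu]_x (\1_E x)%:E = mu E by rewrite integral_indic// setIT.
apply: ge0_le_integral => //.
- by move=> x _; apply: esum_ge0 => v _; rewrite lee_fin.
- by apply/measurable_EFinP; exact: measurable_indic.
move=> x _; rewrite indicE; have [_|/negP nE] := boolP (x \in E).
  by apply: esum_indic_le; exact: h.
rewrite esum1// => v _; rewrite indicE memNset// => /AE xE.
by apply: nE; rewrite inE.
Qed.

End EsumIndic.

Section FairLaw.
Context (R : realType) (mu : probability mconf R).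
Hypothesis fl : fair_law mu.

Lemma mass_transport_set (S : even_pt -> even_pt -> set mconf) :
  (forall u v, measurable (S u v)) ->
  (forall a c u v, S u v (translate a c) <-> S (u + a) (v + a) c) ->
  (\esum_(v in setT) mu (S 0%R v) = \esum_(v in setT) mu (S v 0%R))%E.
Proof.
move=> mS tS.
have I A : measurable A -> (\int[mu]_c (\1_A c)%:E = mu A)%E.
  by move=> mA; rewrite integral_indic// setIT.
transitivity (\esum_(v in setT) \int[mu]_c (\1_(S 0%R v) c)%:E)%E.
  by apply: eq_esum => v _; rewrite I.
rewrite (@mass_transport _ mu fl (fun c u v => (\1_(S u v) c)%:E)).
- by apply: eq_esum => v _; rewrite I.
- by move=> u v; apply/measurable_EFinP; exact: measurable_indic.
- by move=> c u v; rewrite lee_fin.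
- move=> a c u v; rewrite !indicE; congr (_%:R%:E); congr nat_of_bool.
  by apply/idP/idP; rewrite !inE; apply (tS a c u v).
Qed.

Lemma mu_translate a (A : set mconf) : measurable A ->
  mu [set c | A (translate a c)] = mu A.
Proof. exact: fl.1. Qed.

Lemma measurable_flow_eq i u j v : measurable ([set c | flow c i u = flow c j v] : set mconf).
Proof. exact: (measurable_flow2 i u j v (fun x y => x = y)). Qed.

Lemma measurable_flow_neq i u j v : measurable ([set c | flow c i u <> flow c j v] : set mconf).
Proof. exact: (measurable_flow2 i u j v (fun x y => x <> y)). Qed.

Definition has_descendant (c : conf) n v := exists w, flow c n w = v.

Lemma measurable_has_descendant n v :
  measurable ([set c | has_descendant c n v] : set mconf).
Proof.
apply: measurable_exists => w; exact: (measurable_flow n w (fun x => x = v)).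
Qed.

(* Send mass from u to its n-th iterate v when u is the rightmost point with
   that iterate: an expected mass of at most P(u and its right neighbour do not
   merge) is sent, and v receives mass iff it has a descendant. *)
Lemma mu_has_descendant n :
  (mu [set c | has_descendant c n 0%R] <= (survival R n 1)%:E)%E.
Proof.
pose S u v := [set c : mconf | flow c n u = v /\ flow c n (u + hpt 1) <> v].
have mS u v : measurable (S u v).
  exact: (measurable_flow2 n u n (u + hpt 1) (fun x y => x = v /\ y <> v)).
have : (mu [set c | has_descendant c n 0%R] <= \esum_(u in setT) mu (S u 0%R))%E.
  apply: measure_exists_le => [u||c [w hw]].
  - exact: mS.
  - exact: measurable_has_descendant.
  (* If no point with iterate 0 were rightmost, every point [w + hpt k] would flow to 0; but in [n]
     steps a line moves at most [n] sideways. *)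
  apply: contrapT => no.
  have H k : flow c n (w + hpt k%:Z) = 0.
    elim: k => [|k IH].
      by rewrite (_ : w + _ = w)//; apply: even_pt_eq; rewrite ?pxD ?lvD ?px_hpt ?lv_hpt; lia.
    apply: contrapT => hne; apply: no; exists (w + hpt k%:Z); split=> //.
    rewrite (_ : _ + hpt 1 = w + hpt k.+1%:Z)//.
    by apply: even_pt_eq; rewrite ?pxD ?lvD ?px_hpt ?lv_hpt; lia.
  have := px_flow c n (w + hpt n.+1%:Z); have := px_flow c n w.
  by rewrite hw H pxD px_hpt /px /=; lia.
move=> /le_trans; apply.
rewrite -(@mass_transport_set S)//; last first.
  move=> a c u v; rewrite /S /= !flow_translate (addrAC u).
  by split=> -[h1 h2]; split; (try by rewrite -?h1 ?subrK ?h1 ?addrK);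
     move=> h; apply: h2; [rewrite h addrK|rewrite -h subrK].
rewrite -(@mu_not_merged _ mu fl n 1 0 (hpt 1))//.
apply: esum_disjoint_le => //.
- exact: measurable_flow_neq.
- by move=> c v; rewrite /S /= add0r => -[-> h] h'; exact: h.
- by move=> c u v [<- _] [<- _].
Qed.

(** * Coalescence of all flow lines *)

Definition coalesce (c : conf) u v := exists i j, flow c i u = flow c j v.

Lemma coalesce_sym c u v : coalesce c u v -> coalesce c v u.
Proof. by move=> [i [j h]]; exists j, i. Qed.

Lemma coalesce_trans c v u w : coalesce c u v -> coalesce c v w -> coalesce c u w.
Proof.
move=> [i [j h]] [i' [j' h']]; exists (i' + i)%N, (j + j')%N.
by rewrite !flowD h -h' -!flowD addnC.
Qed.

Definition coalescing : set mconf := [set c | forall u v, coalesce c u v].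

Lemma measurable_coalescing : measurable coalescing.
Proof.
apply: measurable_forall => u; apply: measurable_forall => v.
apply: measurable_exists => i; apply: measurable_exists => j.
exact: measurable_flow_eq.
Qed.

Lemma coalescing_neighbours c : (forall u, coalesce c u (u + hpt 1)) ->
  coalescing c.
Proof.
move=> h.
have hk u (k : nat) : coalesce c u (u + hpt k%:Z).
  elim: k => [|k IH].
    by exists 0%N, 0%N; rewrite /flow /=; apply: even_pt_eq; rewrite ?pxD ?lvD ?px_hpt ?lv_hpt; lia.
  apply: (coalesce_trans IH); rewrite (_ : u + hpt k.+1%:Z = u + hpt k%:Z + hpt 1)//.
  by apply: even_pt_eq; rewrite ?pxD ?lvD ?px_hpt ?lv_hpt; lia.
have hl u v : lv u = lv v -> coalesce c u v.
  move=> huv; have [k hk1] := even_parity u; have [l hl1] := even_parity v.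
  have [uv|/ltW vu] := leP (px u) (px v).
    rewrite (_ : v = u + hpt `|l - k|%N%:Z)//.
    by apply: even_pt_eq; rewrite ?pxD ?lvD ?px_hpt ?lv_hpt; lia.
  apply: coalesce_sym; rewrite (_ : u = v + hpt `|l - k|%N%:Z)//.
  by apply: even_pt_eq; rewrite ?pxD ?lvD ?px_hpt ?lv_hpt; lia.
have hf u m : coalesce c u (flow c m u) by exists m, 0%N.
move=> u v; have [uv|/ltW vu] := leP (lv u) (lv v).
  apply: (coalesce_trans (v := flow c `|lv v - lv u|%N v)); last exact/coalesce_sym.
  by apply: hl; rewrite lv_flow; lia.
apply: (coalesce_trans (hf u `|lv v - lv u|%N)).
by apply: hl; rewrite lv_flow; lia.
Qed.

Lemma survival1_lt (e : R) : 0 < e -> exists i, survival R i 1 < e.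
Proof.
move=> e0; exists (Num.bound ((3 / e) ^+ 2)).
set i := Num.bound _.
have hi : (3 / e) ^+ 2 < i.+1%:R.
  by rewrite (lt_trans (archi_boundP _))// ?sqr_ge0// ltr_nat.
have : 3 / e < Num.sqrt i.+1%:R.
  rewrite -(@ltr_pXn2r _ 2)// ?nnegrE ?sqrtr_ge0 ?divr_ge0 ?ltW//.
  by rewrite sqr_sqrtr.
rewrite ltr_pdivrMr// => h; apply: le_lt_trans (survival1_le R i) _.
rewrite ltr_pdivrMr ?sqrtr_gt0// mulrC; lra.
Qed.

(** There are countably many neighbouring pairs, and each stays apart for [i] steps with probability
    [survival i 1], which tends to 0. *)
Lemma mu_coalescing : mu (~` coalescing) = 0%E.
Proof.
pose A u := [set c : mconf | ~ coalesce c u (u + hpt 1)].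
have mA u : measurable (A u).
  apply: (@measurableC _ mconf).
  apply: measurable_exists => i; apply: measurable_exists => j.
  exact: measurable_flow_eq.
have A0 u : mu (A u) = 0%E.
  have : (mu (A u) <= 0)%E.
    apply/lee_addgt0Pr => e e0; rewrite add0e.
    have [i hi] := survival1_lt e0.
    apply: (@le_trans _ _ (survival R i 1)%:E); last by rewrite lee_fin ltW.
    rewrite -(@mu_not_merged _ mu fl i 1 u (u + hpt 1)); last 2 first.
    - by rewrite lvD lv_hpt; lia.
    - by rewrite pxD px_hpt; lia.
    rewrite le_measure ?inE//; first exact: measurable_flow_neq.
    by move=> c hc /= h; apply: hc; exists i, i.
  by move=> h; apply/eqP; rewrite eq_le h measure_ge0.
apply/eqP; rewrite eq_le measure_ge0 andbT.
apply: le_trans (measure_exists_le (A := A) _ _ _ _) _ => //.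
- by apply: measurableC; exact: measurable_coalescing.
- move=> c hc; apply: contrapT => no; apply: hc; apply: coalescing_neighbours => u.
  by apply: contrapT => hu; apply: no; exists u.
- by rewrite esum1 ?lexx// => u _; exact: A0.
Qed.

(** Expected number of [i]-th generation descendants of the [r]-th ancestor of 0. Summed over
    [i <= 2 r] it dominates the expected size of the ball of radius [r], by [walk_flow_eq]. *)
Definition meet_count i r : \bar R :=
  (\esum_(u in setT) mu [set c | flow c i u = flow c r 0%R])%E.

Lemma meet_count_sym i r : meet_count i r = meet_count r i.
Proof.
rewrite /meet_count -(@mass_transport_set (fun u v => [set c | flow c i u = flow c r v])).
- by apply: eq_esum => u _; congr (mu _); apply/seteqP; split=> c /= ->.
- by move=> u v; exact: measurable_flow_eq.
- move=> a c u v; rewrite /= !flow_translate.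
  by split=> [/addIr|->].
Qed.

Lemma meet_count_translate i r a :
  (\esum_(u in setT) mu [set c | flow c i u = flow c r a])%E = meet_count i r.
Proof.
rewrite [LHS](reindex_esum setT setT (fun u => u + a)); last first.
  split=> [//|u v _ _|u _]; first exact: addIr.
  by exists (u - a); rewrite ?subrK.
apply: eq_esum => u _; rewrite -[RHS](mu_translate a); last exact: measurable_flow_eq.
congr (mu _); apply/seteqP; split=> c /=; rewrite !flow_translate add0r; first by move=> ->.
by move/addIr.
Qed.

(** For [i <= r] any [u] that is counted lies strictly below 0, so its line does not read the coin
    at 0. Averaging over this coin replaces 0 by a point one level down, and by translation that
    point is as good as 0. *)
Lemma meet_countS i r : (i <= r)%N -> meet_count i r.+1 = meet_count i r.
Proof.
move=> ir.
pose E u b := [set c : mconf | flow c i u = flow c r (down_step b)].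
have mE u b : measurable (E u b) by exact: measurable_flow_eq.
have H u : (mu [set c | flow c i u = flow c r.+1 0%R] +
            mu [set c | flow c i u = flow c r.+1 0%R] =
            mu (E u true) + mu (E u false))%E.
  have fE b : mu (E u b) = (fine (mu (E u b)))%:E.
    by rewrite fineK// fin_num_measure.
  rewrite (_ : [set c | _] = [set c | E u (c 0) c]); last first.
    by apply/seteqP; split=> c; rewrite /E /= flowSr /drain add0r.
  rewrite (@site_average _ mu fl 0 (E u) _ _ _ _ (fE true) (fE false)).
  - by rewrite (fE true) (fE false) -!EFinD; congr (_%:E); lra.
  - exact: mE.
  - move=> b c; have [u0|u0] := ltP (lv u) 0.
      by rewrite /E /= !flow_flip_lv ?lv_step.
    by split=> /= /(congr1 lv); rewrite !lv_flow lv_step; lia.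
(* The identity is obtained for doubled sums, so that no possibly infinite sum has to be halved. *)
have D : (meet_count i r.+1 + meet_count i r.+1 = meet_count i r + meet_count i r)%E.
  transitivity (\esum_(u in setT) mu (E u true) + \esum_(u in setT) mu (E u false))%E.
    by rewrite /meet_count -!esumD//; apply: eq_esum => u _; exact: H.
  by rewrite /E !meet_count_translate.
have := D; have a0 : (0 <= meet_count i r.+1)%E by exact: esum_ge0.
have b0 : (0 <= meet_count i r)%E by exact: esum_ge0.
case: (meet_count i r.+1) a0 => [x| |]//; case: (meet_count i r) b0 => [y| |]// _ _.
by rewrite -!EFinD => -[h]; congr (_%:E); lra.
Qed.

(** [meet_count_sym], an instance of mass transport, exchanges the indices, so the larger one can
    always be lowered to the smaller. *)
Lemma meet_count_minn i r : meet_count i r = meet_count (minn i r) (minn i r).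
Proof.
have H j k : meet_count j (k + j) = meet_count j j.
  by elim: k => [//|k IH]; rewrite addSn meet_countS ?leq_addl.
have [ir|ri] := leqP i r; first by rewrite -{1}(subnK ir) H.
by rewrite meet_count_sym -{1}(subnK (ltnW ri)) H.
Qed.

(** Summing [survival_rec] over [k] telescopes: one more step adds at most [survival i 1 / 4], hence
    at most 1/(2 sqrt(i+1)), which is below sqrt(i+1) - sqrt i. *)
Lemma merged_sum_le i K : \sum_(k < K) (1 - survival R i k.+1) <= Num.sqrt i%:R.
Proof.
elim: i => [|i IH].
  rewrite sqrtr0 big1// => k _.
  rewrite /survival big_ord_recl /= expr0 addn0 bin1 divr1 big1 => [|l _]; last first.
    by rewrite bin_small ?mul0r//= /bump; lia.
  by rewrite addr0 subrr.
have E : \sum_(k < K) (1 - survival R i.+1 k.+1) =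
   \sum_(k < K) (1 - survival R i k.+1) + survival R i 1 / 4 +
     (survival R i K - survival R i K.+1) / 4.
  clear IH; elim: K => [|K IK]; first by rewrite !big_ord0 survival0; lra.
  by rewrite !big_ord_recr/= IK survival_rec; lra.
rewrite E; apply: (@le_trans _ _ (Num.sqrt i%:R + (2 / Num.sqrt i.+1%:R) / 4)).
  have := survival1_le R i; have : survival R i K <= survival R i K.+1.
    by rewrite (survivalS R i K) lerDl mulr_ge0// invr_ge0 exprn_ge0.
  by move: IH; lra.
have s0 : 0 < Num.sqrt i.+1%:R :> R by rewrite sqrtr_gt0.
have t0 : 0 <= Num.sqrt i%:R :> R by rewrite sqrtr_ge0.
have hs : Num.sqrt i.+1%:R ^+ 2 = i%:R + 1 :> R by rewrite sqr_sqrtr// natr1.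
have ht : Num.sqrt i%:R ^+ 2 = i%:R :> R by rewrite sqr_sqrtr.
set s := Num.sqrt i.+1%:R in s0 hs *; set t := Num.sqrt i%:R in t0 ht *.
have -> : t + 2 / s / 4 = (2 * t * s + 1) / (2 * s) by field; lra.
rewrite ler_pdivrMr; nra.
Qed.

Lemma meet_count_diag i : (meet_count i i <= (1 + 2 * Num.sqrt i%:R)%:E)%E.
Proof.
(* Lines that merge within [i] steps start at most [2 * i] apart on one level, hence at one of
   [2 * i + 1] sites; the shift by [i] makes the index a natural number. *)
pose h (j : nat) := hpt (j%:Z - i%:Z).
pose f u := mu [set c | flow c i u = flow c i 0].
have hf u : ~ (h @` `I_(i.*2.+1)) u -> f u = 0%E.
  move=> hu; rewrite /f (_ : [set _ | _] = set0) ?measure0//.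
  apply/seteqP; split=> c //= e; apply: hu.
  have := congr1 lv e; rewrite !lv_flow {2}/lv /= => l.
  have := px_flow c i u; have := px_flow c i 0; rewrite e {2}/px /= => p1 p2.
  have [k hk] := even_parity u.
  exists (absz (k + i%:Z)); first by rewrite /=; lia.
  by apply: even_pt_eq; rewrite /h ?px_hpt ?lv_hpt; lia.
have fk (j : nat) : f (h j) = (1 - survival R i (`|j%:Z - i%:Z|%N))%:E.
  have -> : f (h j) = mu (~` [set c | flow c i (h j) <> flow c i 0]).
    by congr (mu _); apply/seteqP; split=> c /=; [move=> e; apply|apply: contrapT].
  rewrite probability_setC; last exact: measurable_flow_neq.
  rewrite EFinB; congr (_ - _)%E.
  have [ij|/ltnW ji] := leqP i j.
    rewrite (_ : [set _ | _] = [set c | flow c i 0 <> flow c i (h j)]).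
      by apply: mu_not_merged => //; rewrite px_hpt /px /=; lia.
    by apply/seteqP; split=> c /= e e'; apply: e.
  by apply: mu_not_merged => //; rewrite px_hpt /px /=; lia.
have -> : meet_count i i = (\esum_(u in h @` `I_(i.*2.+1)) f u)%E.
  rewrite [RHS]esum_mkcond; apply: eq_esum => u _; case: ifPn => // /negP nu.
  by apply: hf => hu; apply: nu; rewrite inE.
rewrite esum_image; last by move=> j k _ _ /(congr1 px); rewrite !px_hpt; lia.
rewrite esum_fset//.
rewrite -fsbig_ord.
under eq_bigr do rewrite fk.
rewrite sumEFin lee_fin -addnn -addnS big_split_ord /= big_ord_recl /=.
rewrite addn0 subrr absz0 survival0 subr0.
have := merged_sum_le i i.
have -> : \sum_(j < i) (1 - survival R i `|(i + bump 0 j)%N%:Z - i%:Z|) =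
  \sum_(k < i) (1 - survival R i k.+1).
  by apply: eq_bigr => j _; congr (1 - survival _ _ _); rewrite /= /bump; lia.
have -> : \sum_(j < i) (1 - survival R i `|(j : nat)%:Z - i%:Z|) =
  \sum_(k < i) (1 - survival R i k.+1).
  rewrite (reindex_inj rev_ord_inj); apply: eq_bigr => j _; congr (1 - survival _ _ _) => /=.
  by have := ltn_ord j; lia.
lra.
Qed.

Lemma meet_count_le i r : (meet_count i r <= (1 + 2 * Num.sqrt r%:R)%:E)%E.
Proof.
rewrite meet_count_minn; apply: (le_trans (meet_count_diag _)).
by rewrite lee_fin lerD2l ler_pM2l// ler_sqrt// ler_nat geq_minr.
Qed.

End FairLaw.

(** * Ball sizes *)

Section Good.
Context (R : realType) (mu : probability mconf R).
Hypothesis fl : fair_law mu.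

Lemma markov_le d (X : measurableType d) (m : {measure set X -> \bar R})
    (f : X -> \bar R) (t : R) : measurable_fun setT f ->
  (forall x, 0 <= f x)%E -> 0 <= t ->
  (t%:E * m [set x | t%:E <= f x] <= \int[m]_x f x)%E.
Proof.
move=> mf f0 t0; set A := [set x | _].
have mA : measurable A.
  rewrite -[A]setTI; exact: (emeasurable_fun_c_infty measurableT).
rewrite -integral_cst//.
apply: (@le_trans _ _ (\int[m]_(x in A) f x)%E).
  apply: ge0_le_integral => //; exact: measurable_funTS.
exact: ge0_subset_integral.
Qed.

(* Every point within distance r of v is counted. *)
Definition ball_count (c : mconf) v r : \bar R :=
  (\sum_(i < r.*2.+1) \esum_(u in setT)
     (\1_([set c : mconf | flow c i u = flow c r v]) c)%:E)%E.

Lemma ball_count_ge0 c v r : (0 <= ball_count c v r)%E.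
Proof.
by apply: sume_ge0 => i _; apply: esum_ge0 => u _; rewrite lee_fin.
Qed.

Lemma measurable_ball_count v r :
  measurable_fun setT (fun c => ball_count c v r).
Proof.
apply: emeasurable_sum => i; apply: measurable_esum => [u|u c]; last by rewrite lee_fin.
by apply/measurable_EFinP; apply: measurable_indic; exact: measurable_flow_eq.
Qed.

Lemma ball_count_translate a c v r :
  ball_count (translate a c) v r = ball_count c (v + a) r.
Proof.
apply: eq_bigr => i _; rewrite [RHS](reindex_esum setT setT (fun u => u + a)); last first.
  split=> [//|u w _ _|u _]; first exact: addIr.
  by exists (u - a); rewrite ?subrK.
apply: eq_esum => u _; rewrite !indicE; congr (_%:R%:E); congr nat_of_bool.
by apply/idP/idP; rewrite !inE /= !flow_translate; [move/addIr|move->].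
Qed.

Lemma integral_ball_count r : (0 < r)%N ->
  (\int[mu]_c ball_count c 0%R r <= (9 * (r%:R * Num.sqrt r%:R))%:E)%E.
Proof.
move=> r0.
have mf (i : nat) u : measurable_fun setT (fun c : mconf =>
    (\1_([set c : mconf | flow c i u = flow c r 0]) c)%:E : \bar R).
  by apply/measurable_EFinP; apply: measurable_indic; exact: measurable_flow_eq.
rewrite ge0_integral_sum//; last 2 first.
- by move=> i; apply: measurable_esum => // u c; rewrite lee_fin.
- by move=> i c _; apply: esum_ge0 => u _; rewrite lee_fin.
apply: (@le_trans _ _ (\sum_(i < r.*2.+1) (1 + 2 * Num.sqrt r%:R)%:E)%E).
  apply: lee_sum => i _; rewrite -esum_measureE; first exact: meet_count_le.
  by move=> u; exact: measurable_flow_eq.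
rewrite sumEFin lee_fin sumr_const card_ord -[X in X <= _]mulr_natr.
(* The constant 9 comes from 2r+1 <= 3r and 1 + 2 sqrt r <= 3 sqrt r. *)
have s1 : 1 <= Num.sqrt r%:R :> R by rewrite -{1}sqrtr1 ler_sqrt ?ler1n//.
have r1 : 1 <= r%:R :> R by rewrite ler1n.
have -> : r.*2.+1%:R = 2 * r%:R + 1 :> R by rewrite -natr1 -mul2n natrM.
nra.
Qed.

(** [b] is the growth allowed per doubling of the radius and will be 2^a. Coalescence is included so
    that the metric of the network is the graph distance. *)
Definition good (b K : R) v : set mconf :=
  [set c | coalescing c /\ forall k : nat, (ball_count c v (2 ^ k) <= (K * b ^+ k)%:E)%E].

Lemma measurable_good b K v : measurable (good b K v).
Proof.
apply: (measurableI _ _ measurable_coalescing); apply: measurable_forall => k.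
rewrite -[X in measurable X]setTI.
apply: (emeasurable_fun_infty_c measurableT); exact: measurable_ball_count.
Qed.

Lemma esum_geometric_le (a q : R) : 0 <= a -> 0 <= q -> q < 1 ->
  (\esum_(k in [set: nat]) (a * q ^+ k)%:E <= (a / (1 - q))%:E)%E.
Proof.
move=> a0 q0 q1.
have t0 n : (0 <= (a * q ^+ n)%:E)%E by rewrite lee_fin mulr_ge0// exprn_ge0.
rewrite -nneseries_esumT//; apply: lime_le; first exact: is_cvg_nneseries.
apply: nearW => n; rewrite sumEFin lee_fin big_mkord.
suff -> : \sum_(i < n) a * q ^+ i = a / (1 - q) - a * q ^+ n / (1 - q).
  by rewrite gerBl !mulr_ge0 ?exprn_ge0// invr_ge0 subr_ge0 ltW.
have q' : 1 - q != 0 by rewrite subr_eq0 gt_eqF.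
elim: n => [|n IH]; first by rewrite big_ord0 expr0; field.
by rewrite big_ord_recr /= IH exprS; field.
Qed.

(** The expected ball size is bounded by a multiple of (2 sqrt 2)^k at radius 2^k. By Markov's
    inequality the failure probabilities are bounded by a geometric sequence of ratio 2 sqrt 2 / b <
    1, and a union bound over [k] suffices. *)
Lemma good_prob b : 2 * Num.sqrt 2 < b ->
  exists2 K, 0 < K & ((2^-1)%:E <= mu (good b K 0%R))%E.
Proof.
set s := 2 * Num.sqrt 2 => sb.
have s0 : 0 < s by rewrite mulr_gt0// sqrtr_gt0.
have b0 : 0 < b by exact: lt_trans sb.
pose q := s / b.
have q0 : 0 <= q by rewrite divr_ge0// ltW.
have q1 : q < 1 by rewrite ltr_pdivrMr// mul1r.
(* The failure bounds sum to 9 / (K (1 - q)), which this choice makes 1/2. *)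
pose K := 18 / (1 - q).
have K0 : 0 < K by rewrite divr_gt0// subr_gt0.
exists K => //.
have mb k : measurable [set c : mconf | (ball_count c 0%R (2 ^ k) <= (K * b ^+ k)%:E)%E].
  rewrite -[X in measurable X]setTI.
  apply: (emeasurable_fun_infty_c measurableT); exact: measurable_ball_count.
have mg := measurable_good b K 0.
have sX k : Num.sqrt (2 ^+ k) = Num.sqrt 2 ^+ k :> R.
  by elim: k => [|k IH]; rewrite ?expr0 ?sqrtr1// !exprS sqrtrM// IH.
have hb k : (mu (~` [set c : mconf | (ball_count c 0%R (2 ^ k) <= (K * b ^+ k)%:E)%E]) <=
             (9 / K * q ^+ k)%:E)%E.
  have t0 : 0 < K * b ^+ k by rewrite mulr_gt0// exprn_gt0.
  have := @markov_le _ _ mu _ (K * b ^+ k) (measurable_ball_count 0 (2 ^ k))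
    (fun c => ball_count_ge0 c 0 _) (ltW t0).
  have := @integral_ball_count (2 ^ k) (expn_gt0 2 k).
  have -> : (2 ^ k)%:R * Num.sqrt (2 ^ k)%:R = s ^+ k :> R.
    by rewrite natrX sX exprMn.
  move=> /[swap] /le_trans h /h {h} H.
  rewrite -(@lee_pmul2l _ (K * b ^+ k)%:E)//.
  apply: (@le_trans _ _ (9 * s ^+ k)%:E); last first.
    rewrite -EFinM lee_fin /q expr_div_n.
    have bk : b ^+ k != 0 by rewrite expf_neq0// gt_eqF.
    rewrite le_eqVlt; apply/orP; left; apply/eqP; field.
    by rewrite bk gt_eqF.
  apply: le_trans H; apply: lee_wpmul2l; first by rewrite lee_fin ltW.
  rewrite le_measure ?inE//; first exact: measurableC.
    rewrite -[X in measurable X]setTI.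
    by apply: (emeasurable_fun_c_infty measurableT); exact: measurable_ball_count.
  by move=> c /= /negP; rewrite -ltNge => /ltW.
have hc : (mu (~` good b K 0%R) <= (2^-1)%:E)%E.
  pose E k := ~` [set c : mconf | (ball_count c 0%R (2 ^ k) <= (K * b ^+ k)%:E)%E].
  apply: (@le_trans _ _ (mu (~` coalescing `|` [set c | exists k, E k c]))%E).
    rewrite le_measure ?inE//.
    - exact: measurableC.
    - apply: measurableU; first exact: measurableC measurable_coalescing.
      by apply: measurable_exists => k; exact: measurableC.
    move=> c hc; have [cc|cc] := pselect (coalescing c); last by left.
    right; apply: contrapT => no; apply: hc; split=> // k.
    by apply: contrapT => hk; apply: no; exists k.
  have mE k : measurable (E k) by exact: measurableC.
  have mEE : measurable [set c | exists k, E k c] by exact: measurable_exists.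
  apply: le_trans (measureU2 _ _ _) _ => //.
    exact: measurableC measurable_coalescing.
  rewrite [X in (X + _)%E](mu_coalescing fl) add0e.
  have H1 := @measure_exists_le R _ _ mconf mu E mE _ mEE (fun c h => h).
  apply: (le_trans H1).
  apply: le_trans (le_esum (fun k _ => hb k)) _.
  apply: le_trans (esum_geometric_le _ q0 q1) _.
    by rewrite divr_ge0// ltW.
  rewrite lee_fin /K; rewrite le_eqVlt; apply/orP; left; apply/eqP.
  by field; rewrite subr_eq0 gt_eqF.
move: hc; rewrite probability_setC//.
have : mu (good b K 0%R) \is a fin_num by exact: fin_num_measure.
case: (mu _) => // r _; rewrite -EFinB !lee_fin; lra.
Qed.

End Good.

(** * The drainage network as a random discrete space *)

Section Graph.
Implicit Types (c : conf) (u v w : even_pt).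

Lemma drainageE c u v : drainage c u v = (v == drain c u) || (u == drain c v).
Proof. by rewrite /drainage !drainsE. Qed.

Lemma drainage_sym c : symmetric (drainage c).
Proof. by move=> u v; rewrite /drainage orbC. Qed.

Lemma walk_step (V : Type) (e : rel V) (u v w : V) n :
  e u v -> walk_length e v w n -> walk_length e u w n.+1.
Proof. by move=> uv [p [pp lp sp]]; exists (v :: p); rewrite /= uv lp sp. Qed.

Lemma walk_lengthS (V : Type) (e : rel V) (u w : V) n :
  walk_length e u w n.+1 -> exists2 v, e u v & walk_length e v w n.
Proof. by move=> [[|v p] [//= /andP[uv pp] lp [sp]]]; exists v => //; exists p. Qed.

Lemma walk_length0 (V : Type) (e : rel V) (u w : V) : walk_length e u w 0 -> u = w.
Proof. by move=> [[|a p] [_ /= lp]]. Qed.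

Lemma walk_flow c n u : walk_length (drainage c) u (flow c n u) n.
Proof.
elim: n u => [|n IH] u; first by exists [::].
by rewrite flowSr; apply: walk_step (IH _); rewrite drainageE eqxx.
Qed.

(** An edge of the walk moves the index [i] by one up or down; looking at generation [m >= n] keeps
    it from going below 0. *)
Lemma walk_flow_eq c n u v m : walk_length (drainage c) u v n -> (n <= m)%N ->
  exists i, [/\ (m - n <= i)%N, (i <= m + n)%N & flow c m v = flow c i u].
Proof.
elim: n u m => [|n IH] u m.
  by move=> /(@walk_length0 _ _ _ _) -> _; exists m; split => //; lia.
move=> /(@walk_lengthS _ _ _ _ _)[w uw /IH h] nm; have [|i [i1 i2 hi]] := h m; first by lia.
move: uw; rewrite drainageE => /orP[] /eqP wu.
  by exists i.+1; rewrite flowSr -wu hi; split => //; lia.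
case: i i1 i2 hi => [|i] i1 i2 hi; first by lia.
by exists i; rewrite hi flowSr -wu; split => //; lia.
Qed.

Lemma walk_lv c n u v : walk_length (drainage c) u v n -> `|lv v - lv u| <= n%:Z.
Proof.
by move=> /walk_flow_eq/(_ (leqnn n)) [i [i1 i2 /(congr1 lv)]]; rewrite !lv_flow; lia.
Qed.

Lemma coalescing_discrete_graph c : discrete_graph (drainage c) <-> coalescing c.
Proof.
split=> [[_ _ gc] u v|cc].
  have [n /walk_flow_eq/(_ (leqnn n))[i [_ _ h]]] := gc u v.
  by exists i, n.
split; first exact: drainage_sym.
  move=> u; apply: (@sub_finite_set _ _ (range (fun b => u + down_step b) `|`
     range (fun b => u - down_step b))); last by rewrite finite_setU; split; exact: finite_image.
  move=> v /=; rewrite drainageE => /orP[] /eqP ->; [left|right].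
    by exists (c u).
  by exists (c v) => //; rewrite /drain addrK.
move=> u v; have [i [j h]] := cc u v; exists (i + j)%N.
apply: walk_cat (walk_flow c i u) _; rewrite h.
by apply: walk_rev; [exact: drainage_sym|exact: walk_flow].
Qed.

Definition gd c u v := graph_dist (drainage c) u v.

Lemma gdP c u v : coalescing c -> walk_length (drainage c) u v (gd c u v).
Proof. by move=> /coalescing_discrete_graph[_ _ gc]; exact: graph_distP. Qed.

Lemma gd_flow c n u : coalescing c -> gd c u (flow c n u) = n.
Proof.
move=> cc; apply/eqP; rewrite eqn_leq graph_dist_le; last exact: walk_flow.
by have := walk_lv (gdP u (flow c n u) cc); rewrite lv_flow; lia.
Qed.

Lemma gd_sym c u v : coalescing c -> gd c u v = gd c v u.
Proof.
move=> cc; apply/eqP; rewrite eqn_leq.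
by apply/andP; split; apply: graph_dist_le; apply: walk_rev (drainage_sym c) _; exact: gdP.
Qed.

Lemma gd_triangle c v u w : coalescing c -> (gd c u w <= gd c u v + gd c v w)%N.
Proof. by move=> cc; apply: graph_dist_le; apply: walk_cat; exact: gdP. Qed.

(* A walk can enter the subtree of descendants of v only through v, coming from
   its parent. *)
Lemma walk_nondescendant c n v w : walk_length (drainage c) w v n ->
  (forall i, flow c i w <> v) ->
  exists2 k, (k < n)%N & walk_length (drainage c) w (drain c v) k.
Proof.
elim: n w => [|n IH] w; first by move=> /(@walk_length0 _ _ _ _) -> /(_ 0%N).
move=> /(@walk_lengthS _ _ _ _ _)[a wa wl] nd.
have [[i hi]|na] := pselect (exists i, flow c i a = v).
  move: wa; rewrite drainageE => /orP[] /eqP e.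
    by have := nd i.+1; rewrite flowSr -e.
  case: i hi => [|i] hi; last by have := nd i; rewrite e -flowSr.
  by exists 0%N => //; exists [::]; rewrite e -hi.
have [|k kn wk] := IH a wl; first by move=> i hi; apply: na; exists i.
by exists k.+1; [|exact: walk_step wa wk].
Qed.

Lemma gd_nondescendant c v w : coalescing c -> (forall i, flow c i w <> v) ->
  (gd c w (drain c v) < gd c w v)%N.
Proof.
move=> cc /(walk_nondescendant (gdP w v cc))[k kn wk].
by apply: leq_ltn_trans kn; exact: graph_dist_le.
Qed.

(* In a one-ended tree, v is the midpoint of a geodesic with legs of lengths
   k <= M iff it has a descendant k generations away: one leg may follow the
   ancestors of v, but not both. *)
Lemma geodesic_has_descendant c k M v : coalescing c -> (k <= M)%N ->
  (exists w1 w2, [/\ gd c v w1 = k, gd c v w2 = M & gd c w1 w2 = (k + M)%N]) <->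
  has_descendant c k v.
Proof.
move=> cc kM; split=> [[w1 [w2 [h1 h2 h12]]]|[w hw]]; last first.
  exists w, (flow c M v); split.
  - by rewrite gd_sym// -hw gd_flow.
  - exact: gd_flow.
  - by rewrite -hw -flowD gd_flow// addnC.
have [[i hi]|n1] := pselect (exists i, flow c i w1 = v).
  by exists w1; rewrite -h1 gd_sym// -hi gd_flow.
have [[i hi]|n2] := pselect (exists i, flow c i w2 = v).
  have iM : i = M by rewrite -h2 gd_sym// -hi gd_flow.
  by exists (flow c (M - k) w2); rewrite -flowD subnKC// -iM.
have l1 : (gd c w1 (drain c v) < gd c w1 v)%N.
  by apply: gd_nondescendant => // i hi; apply: n1; exists i.
have l2 : (gd c w2 (drain c v) < gd c w2 v)%N.
  by apply: gd_nondescendant => // i hi; apply: n2; exists i.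
have := gd_triangle (drain c v) w1 w2 cc.
by rewrite (gd_sym (drain c v) w2 cc) h12 -h1 -h2 (gd_sym v w1 cc) (gd_sym v w2 cc); lia.
Qed.

Lemma drainage_translate a c u v :
  drainage (translate a c) u v = drainage c (u + a) (v + a).
Proof.
rewrite !drainageE /drain /translate !(addrAC _ a (down_step _)).
by rewrite !(inj_eq (addIr a)).
Qed.

Lemma walk_translate a c n u v :
  walk_length (drainage (translate a c)) u v n <->
  walk_length (drainage c) (u + a) (v + a) n.
Proof.
elim: n u => [|n IH] u.
  split=> /(@walk_length0 _ _ _ _); first by move=> ->; exists [::].
  by move=> /addIr ->; exists [::].
split=> /(@walk_lengthS _ _ _ _ _)[w uw wl].
  by apply: (walk_step (v := w + a)); [rewrite -drainage_translate|exact/IH].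
apply: (walk_step (v := w - a)); first by rewrite drainage_translate subrK.
by apply/IH; rewrite subrK.
Qed.

Lemma coalescing_translate a c : coalescing (translate a c) <-> coalescing c.
Proof.
split=> h u v.
  have [i [j]] := h (u - a) (v - a); rewrite !flow_translate !subrK => /addIr e.
  by exists i, j.
by have [i [j e]] := h (u + a) (v + a); exists i, j; rewrite !flow_translate e.
Qed.

Lemma gd_translate a c u v : coalescing c ->
  gd (translate a c) u v = gd c (u + a) (v + a).
Proof.
move=> cc; have cc' : coalescing (translate a c) by exact/coalescing_translate.
apply/eqP; rewrite eqn_leq; apply/andP; split; apply: graph_dist_le.
  by apply/walk_translate; exact: gdP.
by apply/walk_translate; exact: gdP.
Qed.

Definition nrm u : nat := maxn (absz (px u)) (absz (lv u)).

Lemma nrm_drain c u v : drainage c u v -> (nrm v <= (nrm u).+1)%N.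
Proof.
rewrite drainageE /nrm => /orP[] /eqP ->; rewrite lv_drain px_drain.
  by case: (c u); lia.
by case: (c v); lia.
Qed.

Lemma nrm_walk c n u v : walk_length (drainage c) u v n -> (nrm v <= nrm u + n)%N.
Proof.
elim: n u => [|n IH] u; first by move=> /(@walk_length0 _ _ _ _) ->; rewrite addn0.
by move=> /(@walk_lengthS _ _ _ _ _)[w /nrm_drain h /IH]; lia.
Qed.

Lemma walk_local c c' L n u v : (forall p, (nrm p <= L)%N -> c p = c' p) ->
  (nrm u + n <= L)%N ->
  walk_length (drainage c) u v n -> walk_length (drainage c') u v n.
Proof.
move=> cL; elim: n u => [|n IH] u hu; first by move=> /(@walk_length0 _ _ _ _) ->; exists [::].
move=> /(@walk_lengthS _ _ _ _ _)[w uw wl]; have hw := nrm_drain uw.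
apply: walk_step (IH _ _ wl); last by lia.
by move: uw; rewrite !drainageE /drain !cL//; lia.
Qed.

Lemma gd_local c c' L u v : (forall p, (nrm p <= L)%N -> c p = c' p) ->
  coalescing c -> coalescing c' -> (nrm u + gd c u v <= L)%N ->
  gd c u v = gd c' u v.
Proof.
move=> cL cc cc' hL.
have h : (gd c' u v <= gd c u v)%N.
  by apply: graph_dist_le; apply: walk_local cL hL _; exact: gdP.
apply/eqP; rewrite eqn_leq h andbT; apply: graph_dist_le.
by apply: (@walk_local c' c L) (gdP u v cc'); [move=> p /cL|lia].
Qed.

End Graph.

Section Net.
Context (R : realType).
Local Notation net := (drainage_network R).

Lemma graph_metricE c num u v : coalescing c ->
  graph_metric R (drainage c) num u v = (gd c u v)%:R.
Proof.
by move=> /coalescing_discrete_graph h; rewrite /graph_metric; case: pselect.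
Qed.

Lemma net_dist c (u v : net c) : coalescing c -> dist u v = (gd c u v)%:R.
Proof. exact: graph_metricE.
Qed.


Lemma pspace_dist_le (X Y : pspace R) e : 0 < e ->
  (exists f : X -> Y, eps_embeds e f) -> (exists f : Y -> X, eps_embeds e f) ->
  pspace_dist X Y <= e.
Proof.
move=> e0 hf hg; rewrite /pspace_dist ge_min; apply/orP; right.
apply: ge_inf; last by split.
by exists 0 => x [/ltW].
Qed.


(** Points of the [K]-ball have norm at most [K] and mutual distance at most [2 * K], so geodesics
    between them read no coin at norm above [3 * K]. *)
Lemma net_local c c' (e : R) (K : nat) : 0 < e -> e^-1 <= K%:R ->
  coalescing c -> coalescing c' ->
  (forall p, (nrm p <= 3 * K)%N -> c p = c' p) ->
  pspace_dist (net c) (net c') <= e.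
Proof.
move=> e0 eK.
have H c1 c2 : coalescing c1 -> coalescing c2 ->
    (forall p, (nrm p <= 3 * K)%N -> c1 p = c2 p) ->
    eps_embeds (X := net c1) (Y := net c2) e (fun x => x).
  move=> cc1 cc2 h; split=> //= x y; rewrite !graph_metricE// => bx byy.
  have gx : (gd c1 even_pt0 x <= K)%N by rewrite -(ler_nat R); exact: le_trans eK.
  have gy : (gd c1 even_pt0 y <= K)%N by rewrite -(ler_nat R); exact: le_trans eK.
  have nx := nrm_walk (gdP even_pt0 x cc1).
  have := gd_triangle even_pt0 x y cc1; rewrite (gd_sym x even_pt0 cc1) => gxy.
  rewrite (gd_local h cc1 cc2) ?subrr ?normr0 ?ltW//.
  by move: nx; rewrite [nrm even_pt0]/nrm /px /lv /=; lia.
move=> cc cc' h; apply: pspace_dist_le => //.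
  by exists (fun x => x); exact: H.
by exists (fun x => x); apply: H => // p /h.
Qed.

(** On coalescing configurations the network depends locally on the coins, so an open set pulls back
    to a union of cylinders, of which there are countably many. All other configurations give the
    one metric pulled back from the numbering, so an open set contains all or none of their
    networks. *)
Lemma measurable_net (B : set (pspace R)) : borel_for (@pspace_dist R) B ->
  measurable ([set c | B (net c)] : set mconf).
Proof.
pose S := [set B : set (pspace R) | measurable ([set c | B (net c)] : set mconf)].
suff : sigma_algebra setT S /\ open_for (@pspace_dist R) `<=` S.
  by move=> hS h; exact: (h S hS).
split.
  split.
  - by rewrite /S /= (_ : [set _ | _] = set0)//; apply/seteqP; split.
  - move=> A mA; rewrite /S /= (_ : [set _ | _] = ~` [set c : mconf | A (net c)]).
      exact: measurableC.
    by apply/seteqP; split=> c //= [].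
  - move=> F mF; rewrite /S /= (_ : [set _ | _] = \bigcup_i [set c : mconf | F i (net c)]).
      exact: bigcupT_measurable.
    by apply/seteqP; split=> c /= [i _ ?]; exists i.
move=> U oU; rewrite /S /=.
have mcc := measurable_coalescing.
rewrite (_ : [set _ | _] = ([set c : mconf | coalescing c /\ U (net c)]) `|`
  ([set c : mconf | ~ coalescing c /\ U (net c)])); last first.
  apply/seteqP; split=> c /=; last by case=> [] [].
  by have [?|?] := pselect (coalescing c); [left|right].
apply: measurableU.
  pose ok (s : seq (even_pt * bool)) := coalescing `&` cyl s `<=` [set c | U (net c)].
  rewrite (_ : [set _ | _] = coalescing `&`
      [set c : mconf | exists s, ok s /\ cyl s c]).
    apply: measurableI => //; apply: measurable_exists => s.
    apply: (measurableI [set c : mconf | ok s] (cyl s)); first exact: measurable_prop.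
    by apply: sub_sigma_algebra; exists s.
  apply/seteqP; split=> c /= [cc]; last first.
    by move=> [s [oks cs]]; split=> //; apply: oks; split.
  move=> Uc; split=> //; have [e e0 he] := oU _ Uc.
  pose K := Num.bound ((e / 2)^-1).
  have e20 : 0 < e / 2 by rewrite divr_gt0.
  have Kp : (e / 2)^-1 <= K%:R by rewrite ltW// archi_boundP// invr_ge0 ltW.
  have fb : finite_set [set p | (nrm p <= 3 * K)%N].
    pose box := [set x : int | (absz x <= 3 * K)%N].
    have fbox : finite_set box.
      apply: (@sub_finite_set _ _ ([set n%:Z | n in `I_(3 * K).+1] `|`
          [set - n%:Z | n in `I_(3 * K).+1])).
        move=> x; rewrite /box /= => hx.
        by have [x0|x0] := leP 0 x; [left|right]; exists (absz x) => /=; lia.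
      by rewrite finite_setU; split; exact: finite_image.
    apply: (@sub_finite_set _ _ ((fun p : even_pt => val p) @^-1` (box `*` box))).
      by move=> p; rewrite /nrm /= geq_max => /andP[].
    by apply: finite_preimage; [move=> ? ? _ _; exact: val_inj|exact: finite_setX].
  have /finite_seqP[bs bsE] := fb.
  exists [seq (p, c p) | p <- bs].
  split; last by rewrite /cyl /=; apply/allP => _ /mapP[p _ ->] /=.
  move=> c' [cc' /allP h]; apply: he.
  apply: le_lt_trans (@net_local _ _ (e / 2) K e20 Kp cc cc' _) _; last by lra.
  move=> p hp; have := h (p, c p) _; rewrite /= => hh; apply/esym/eqP; apply: hh.
  by apply: map_f; have : [set p | (nrm p <= 3 * K)%N] p by []; rewrite bsE.
have [[c0 [nc0 Uc0]]|no] := pselect (exists c0, ~ coalescing c0 /\ U (net c0)); last first.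
  rewrite (_ : [set _ | _] = set0)//; apply/seteqP; split=> c //= h.
  by apply: no; exists c.
rewrite (_ : [set _ | _] = ~` coalescing); first exact: measurableC.
apply/seteqP; split=> c /=; first by case.
move=> nc; split=> //; have [e e0 he] := oU _ Uc0; apply: he.
have dE c1 num u v : ~ coalescing c1 -> graph_metric R (drainage c1) num u v =
    `|(num u)%:R - (num v)%:R|.
  move=> nc1; rewrite /graph_metric; case: pselect => // h.
  by case: nc1; apply/coalescing_discrete_graph.
have e20 : 0 < e / 2 by rewrite divr_gt0.
apply: (@le_lt_trans _ _ (e / 2)); last by lra.
apply: pspace_dist_le => //; exists (fun x => x); split=> //= x y _ _;
  by rewrite !dE// subrr normr0 ltW.
Qed.

Lemma measurable_net_fun (f : pspace R -> \bar R) : measurable_on_classes f ->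
  measurable_fun setT (fun c : mconf => f (net c)).
Proof.
move=> mf _ B mB; rewrite setTI.
exact: (measurable_net (mf B mB)).
Qed.

End Net.

(** * Equivariant processes with radii *)

(* No measurability is assumed: the integral of a nonnegative function is a
   supremum over the simple functions below it. *)
Lemma ge0_le_integral_any d (T : measurableType d) (R : realType)
    (mu : {measure set T -> \bar R}) (f g : T -> \bar R) :
  (forall x, 0 <= f x)%E -> (forall x, f x <= g x)%E ->
  (\int[mu]_x f x <= \int[mu]_x g x)%E.
Proof.
move=> f0 fg.
have g0 x : (0 <= g x)%E by exact: le_trans (f0 x) (fg x).
rewrite !ge0_integralTE//; apply: le_ereal_sup => _ [h hf <-].
by exists h => // x; exact: le_trans (hf x) (fg x).
Qed.

Section MspaceDist.
Context (R : realType).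

Lemma small_ball (X : pspace R) : exists e0 : R, forall e, e0 <= e -> 0 < e ->
  forall x, dist (origin X) x <= e^-1 -> x = origin X.
Proof.
pose B := [set y | dist (origin X) y <= 1].
have /finite_seqP[s sE] : finite_set ((fun y => (dist (origin X) y)^-1) @` B).
  exact/finite_image/dist_finite.
have [m hm] : exists m, forall x, x \in s -> x <= m.
  elim: s {sE} => [|a s [m hm]]; first by exists 0.
  exists (Num.max a m) => x; rewrite inE le_max => /orP[/eqP ->|/hm ->].
    by rewrite lexx.
  by rewrite orbT.
exists (Num.max 1 (m + 1)) => e; rewrite ge_max => /andP[e1 em] e0 x xe.
apply: contrapT => xo.
have d0 : 0 < dist (origin X) x.
  have := dist_triangle x (origin X) (origin X).
  rewrite distxx (dist_sym x) => d0.
  rewrite lt0r; apply/andP; split; last by lra.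
  by apply/eqP => /dist_eq0 ?; apply: xo.
have x1 : dist (origin X) x <= 1 by apply: (le_trans xe); rewrite invf_le1.
have : (dist (origin X) x)^-1 \in s.
  have : ((fun y => (dist (origin X) y)^-1) @` B) (dist (origin X) x)^-1 by exists x.
  by rewrite sE.
move=> /hm; have : e <= (dist (origin X) x)^-1.
  by rewrite -[e]invrK lef_pV2 ?posrE ?invr_gt0.
by lra.
Qed.

(** The real-valued [inf] is 0 on the empty set, so extracting an embedding from a small distance
    requires this set to be nonempty. For large [e] the ball of radius [e^-1] is just the origin. *)
Lemma eps_membeds_exist (Xi : metricType R) (X Y : mspace Xi) :
  [set e | 0 < e /\ (exists f : X -> Y, eps_membeds e f) /\
     (exists f : Y -> X, eps_membeds e f)] !=set0.
Proof.
have [eX hX] := small_ball X; have [eY hY] := small_ball Y.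
pose m := mdist (mark (origin X) (origin X)) (mark (origin Y) (origin Y)).
pose e := Num.max 1 (Num.max (Num.max eX eY) m).
have e0 : 0 < e by rewrite /e lt_max ltr01.
have eXe : eX <= e by rewrite /e !le_max lexx !orbT.
have eYe : eY <= e by rewrite /e !le_max lexx !orbT.
have eme : m <= e by rewrite /e !le_max lexx !orbT.
exists e; split=> //; split.
  exists (fun _ => origin Y); split.
    split=> // x y; first by move=> /(hX e eXe e0) -> /(hX e eXe e0) ->.
    by move=> /(hX e eXe e0) -> /(hX e eXe e0) ->; rewrite !distxx subrr normr0 ltW.
  by move=> x y /(hX e eXe e0) -> /(hX e eXe e0) ->; rewrite metric_sym.
exists (fun _ => origin X); split.
  split=> // x y; first by move=> /(hY e eYe e0) -> /(hY e eYe e0) ->.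
  by move=> /(hY e eYe e0) -> /(hY e eYe e0) ->; rewrite !distxx subrr normr0 ltW.
by move=> x y /(hY e eYe e0) -> /(hY e eYe e0) ->.
Qed.

Lemma mspace_dist_lt (Xi : metricType R) (X Y : mspace Xi) (e : R) : e <= 1 ->
  mspace_dist X Y < e ->
  exists2 e', 0 < e' < e & (exists f : X -> Y, eps_membeds e' f) /\
     (exists f : Y -> X, eps_membeds e' f).
Proof.
move=> e1; rewrite /mspace_dist gt_min => /orP[|]; first by move=> h; lra.
move=> /(inf_lt (eps_membeds_exist X Y))[e' [e'0 h] e'e].
by exists e' => //; rewrite e'0.
Qed.

End MspaceDist.

Section Radius.
Context (R : realType) (A : set R) (rho : R -> R).
Hypothesis rho_closed : forall t, 1 <= t -> closed [set x | t <= rho x].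

Lemma rho_lt_open t x : 1 <= t -> rho x < t ->
  exists2 e, 0 < e & forall y, `|x - y| < e -> rho y < t.
Proof.
move=> t1 xt; have oA := closed_openC (rho_closed t1).
have : nbhs x (~` [set x | t <= rho x]).
  by apply: open_nbhs_nbhs; split => //=; apply/negP; rewrite -ltNge.
move=> /nbhs_ballP[e e0 he]; exists e => // y xy.
by have := he y xy; rewrite /= => /negP; rewrite -ltNge.
Qed.

Lemma marks_lt_open t : 1 <= t -> open [set x : marks_in A | rho (val x) < t].
Proof.
move=> t1; rewrite openE => x xt; have [e e0 he] := rho_lt_open t1 xt.
apply/nbhs_ballP; exists e => // y; rewrite ballEmdist /=; exact: he.
Qed.

Context (Z : eprocess (marks_in A)).

(** Reading the radius through [rho] covers both kinds of processes: subsets, whose points carry a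
    fixed radius, and radii given by the marks themselves. *)
Definition reach (D : dspace R) (v : D) (t : R) : set (ep_sample Z D) :=
  [set z | t <= rho (point_mark z v)].

Lemma marking_measurable_reach (D : dspace R) (v : D) t : 1 <= t ->
  marking_measurable [set m : D -> D -> marks_in A | t <= rho (val (m v v))].
Proof.
move=> t1; rewrite (_ : [set _ | _] = setT `\`
    [set m : D -> D -> marks_in A | [set x | rho (val x) < t] (m v v)]); last first.
  by apply/seteqP; split=> m /=; rewrite leNgt; [move/negP; split|move=> [_] /negP].
apply: sigma_algebraCD; apply: sub_sigma_algebra.
exists v, v, [set x : marks_in A | rho (val x) < t]; split => //.
exact: marks_lt_open.
Qed.

Lemma measurable_reach (D : dspace R) (v : D) t : 1 <= t ->
  measurable (reach v t).
Proof. by move=> t1; exact: (@ep_measurable _ _ Z _ _ (marking_measurable_reach v t1)). Qed.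

Lemma reach_kernel t : 1 <= t ->
  measurable_on_classes (fun X : pspace R => ep_prob Z X (reach (origin X) t)).
Proof.
move=> t1; apply: (@ep_kernel _ _ Z
  [set M : mspace (marks_in A) | t <= rho (val (mark (origin M) (origin M)))]).
rewrite (_ : [set _ | _] = setT `\`
    [set M : mspace (marks_in A) | rho (val (mark (origin M) (origin M))) < t]); last first.
  by apply/seteqP; split=> m /=; rewrite leNgt; [move/negP; split|move=> [_] /negP].
apply: sigma_algebraCD; apply: sub_sigma_algebra => X /= Xt.
have [e e0 he] := rho_lt_open t1 Xt.
(* The distance is capped at 1, so it yields an embedding only below thresholds at most 1. *)
exists (Num.min e 1); first by rewrite lt_min e0 ltr01.
move=> Y; move=> /mspace_dist_lt => /(_ _)[|e' /andP[e'0 e'e] [[f [[fo _ _] fm]] _]].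
  by rewrite ge_min lexx orbT.
apply: he; rewrite -fo.
have := fm (origin X) (origin X); rewrite distxx invr_ge0 ltW// => /(_ isT isT).
rewrite metric_sym => h; apply: le_lt_trans (h) _.
by move: e'e; rewrite lt_min => /andP[].
Qed.

Lemma reach_iso (D1 D2 : dspace R) (f : D1 -> D2) (g : D2 -> D1) x t :
  cancel f g -> cancel g f -> (forall x y, dist (f x) (f y) = dist x y) -> 1 <= t ->
  ep_prob Z D1 (reach x t) = ep_prob Z D2 (reach (f x) t).
Proof.
move=> fg gf fd t1.
have := ep_equivariant Z fg gf fd (marking_measurable_reach (f x) t1).
by rewrite /reach /point_mark /= fg.
Qed.

End Radius.

Lemma measurable_walk u v n :
  measurable ([set c | walk_length (drainage c) u v n] : set mconf).
Proof.
elim: n u => [|n IH] u.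
  rewrite (_ : [set _ | _] = [set c : mconf | u = v]); first exact: measurable_prop.
  by apply/seteqP; split=> c /=; [exact: walk_length0|move=> ->; exists [::]].
rewrite (_ : [set _ | _] = [set c : mconf | exists w,
    drainage c u w /\ walk_length (drainage c) w v n]); last first.
  apply/seteqP; split=> c /=; first by move=> /(@walk_lengthS _ _ _ _ _)[w ? ?]; exists w.
  by move=> [w [? ?]]; exact: (walk_step (v := w)).
apply: measurable_exists => w; apply: (measurableI [set c : mconf | drainage c u w] _ _ (IH w)).
rewrite (_ : [set _ | _] = [set c : mconf | w = flow c 1 u] `|` [set c : mconf | u = flow c 1 w]).
  by apply: measurableU; [exact: (measurable_flow 1 u (fun x => w = x))|
                         exact: (measurable_flow 1 w (fun x => u = x))].
apply/seteqP; split=> c /=; rewrite drainageE.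
  by move=> /orP[] /eqP h; [left|right].
by move=> [] ->; rewrite /flow /= eqxx ?orbT.
Qed.

Lemma gd_eq_walk c u v n : coalescing c ->
  gd c u v = n <-> walk_length (drainage c) u v n /\
    forall k : 'I_n, ~ walk_length (drainage c) u v k.
Proof.
move=> cc; split=> [<-|[wn nw]].
  split; first exact: gdP.
  by move=> k wk; have := graph_dist_le wk; have := ltn_ord k; rewrite /gd; lia.
apply/eqP; rewrite eqn_leq; apply/andP; split; first exact: graph_dist_le.
by rewrite leqNgt; apply/negP => h; apply: (nw (Ordinal h)); exact: gdP.
Qed.

Lemma measurable_gd (Q : set mconf) u v n : measurable Q -> Q `<=` coalescing ->
  measurable [set c : mconf | Q c /\ gd c u v = n].
Proof.
move=> mQ Qc; rewrite (_ : [set _ | _] = Q `&` ([set c : mconf |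
    walk_length (drainage c) u v n] `&` [set c : mconf | forall k : 'I_n, ~ walk_length (drainage c) u v k])).
  apply: measurableI => //; apply: measurableI; first exact: measurable_walk.
  by apply: measurable_forall => k; apply: measurableC; exact: measurable_walk.
by apply/seteqP; split=> c /= [Qx h]; split=> //; apply/gd_eq_walk => //; exact: Qc.
Qed.

Lemma good_coalescing (R : realType) (b K : R) v : good b K v `<=` coalescing.
Proof. by move=> c []. Qed.

Lemma good_translate (R : realType) (b K : R) a c v :
  good b K v (translate a c) <-> good b K (v + a) c.
Proof.
have [ct1 ct2] := coalescing_translate a c.
split=> -[cc h]; split.
- exact: ct1.
- by move=> k; rewrite -ball_count_translate.
- exact: ct2.
- by move=> k; rewrite ball_count_translate.
Qed.

Section Count.
Context (R : realType).

Lemma indic_prop (T : Type) (A : set T) x : A x -> \1_A x = 1 :> R.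
Proof. by move=> h; rewrite indicE mem_set. Qed.

Lemma indic_propN (T : Type) (A : set T) x : ~ A x -> \1_A x = 0 :> R.
Proof. by move=> h; rewrite indicE memNset. Qed.

(* If v0 is a good point of the ball of radius n then this ball lies in the ball
   of radius 2 n around v0, whose size is controlled. *)
Lemma good_count (b K : R) c (n : nat) : (0 < n)%N -> 1 <= b -> 0 < K ->
  (\esum_(v in setT) (\1_([set v | good b K v c /\ (gd c 0%R v <= n)%N]) v)%:E
   <= (K * b ^+ (up_log 2 n.*2))%:E)%E.
Proof.
move=> n0 b1 K0.
have [[v0 [g0 h0]]|no] := pselect (exists v, good b K v c /\ (gd c 0%R v <= n)%N); last first.
  rewrite esum1 ?lee_fin ?mulr_ge0 ?exprn_ge0//; [lra|lra|].
  by move=> v _; rewrite indic_propN// => h; apply: no; exists v.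
have [cc hb] := g0; set m := up_log 2 n.*2; apply: le_trans (hb m).
rewrite /ball_count -esum_sum; last by move=> *; rewrite lee_fin.
apply: le_esum => v _; have [[gv hv]|nv] := pselect (good b K v c /\ (gd c 0%R v <= n)%N);
  last by rewrite indic_propN ?sume_ge0// => *; rewrite lee_fin.
rewrite indic_prop//.
have := gd_triangle 0 v v0 cc; rewrite (gd_sym v 0 cc) => tri.
have n2 : (gd c v v0 <= 2 ^ m)%N.
  have /andP[_] := @up_log_bounds 2 n.*2 (isT) (ltac:(lia)).
  by rewrite -/m; lia.
have [i [i1 i2 hi]] := walk_flow_eq (gdP v v0 cc) n2.
have ilt : (i < (2 ^ m).*2.+1)%N by lia.
rewrite (bigD1 (Ordinal ilt))//= indic_prop; last by rewrite /= hi.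
by rewrite leeDl// sume_ge0// => *; rewrite lee_fin.
Qed.

Lemma good_count_real (a K : R) c (r : R) : 0 <= a -> 0 < K -> 1 <= r ->
  (\esum_(v in setT) (\1_([set v | good (2 `^ a) K v c /\ (maxn 1 (gd c 0%R v))%:R <= r]) v)%:E
   <= (K * 4 `^ a * r `^ a)%:E)%E.
Proof.
move=> a0 K0 r1; pose n := Num.truncn r.
have r0 : 0 <= r by lra.
have n0 : (0 < n)%N by rewrite truncn_gt0.
have b1 : 1 <= 2 `^ a.
  have h2 : 1 <= 2 :> R by lra.
  by have := ler_powR h2 a0; rewrite powRr0.
have := @good_count (2 `^ a) K c n n0 b1 K0.
set s1 := esum _ _ => h1; set s2 := esum _ _.
have s21 : (s2 <= s1)%E.
  apply: le_esum => v _; rewrite lee_fin.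
  have [[gv hv]|nv] := pselect (good (2 `^ a) K v c /\ (maxn 1 (gd c 0%R v))%:R <= r); last first.
    by rewrite indic_propN.
  rewrite indic_prop// indic_prop//; split=> //.
  by rewrite truncn_ge_nat//; apply: le_trans hv; rewrite ler_nat leq_maxr.
apply: (le_trans s21); apply: (le_trans h1); rewrite lee_fin -mulrA ler_pM2l//.
have n2 : (1 < n.*2)%N by lia.
have /andP[hk _] := @up_log_bounds 2 n.*2 isT n2.
set k := up_log 2 n.*2 in hk *.
(* Rounding [2 * n] up to a power of 2 at most doubles it: this is the source of the factor 4^a. *)
have kE : (2 ^ k <= n * 4)%N.
  have : (0 < k)%N by rewrite up_log_gt0.
  by case: k hk => // k hk _; rewrite expnS; move: hk; rewrite /=; lia.
rewrite -powR_mulrn ?powR_ge0// -powRrM mulrC powRrM powR_mulrn//.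
rewrite -powRM//; apply: ge0_ler_powR; rewrite ?nnegrE ?mulr_ge0 ?exprn_ge0//.
apply: (@le_trans _ _ (n * 4)%:R); first by rewrite -natrX ler_nat.
by rewrite natrM mulrC ler_pM2l// truncn_le.
Qed.

End Count.

(** * The mass distribution principle *)

Lemma esum_single (R : realType) (T : choiceType) (a : T -> \bar R) v :
  (0 <= a v)%E -> (forall u, u <> v -> a u = 0%E) ->
  (\esum_(u in setT) a u = a v)%E.
Proof.
move=> av h; rewrite -[RHS](@esum_set1 R _ v a)// [RHS]esum_mkcond.
apply: eq_esum => u _; case: ifPn => //; rewrite notin_setE /= => uv.
exact: h.
Qed.

Section Transport.
Context (R : realType) (A : set R) (rho : R -> R).
Hypothesis rho_closed : forall t, 1 <= t -> closed [set x | t <= rho x].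
Context (Z : eprocess (marks_in A)).
Local Notation net := (drainage_network R).

Definition reach_prob c (v : even_pt) (t : R) : \bar R :=
  ep_prob Z (net c) (reach rho (v : net c) t).

Lemma measurable_reach_prob t : 1 <= t ->
  measurable_fun setT (fun c : mconf => reach_prob c 0 t).
Proof.
by move=> t1; apply: (measurable_net_fun (reach_kernel rho_closed Z t1)).
Qed.

(** Translation is an isometry between the two networks, and isometries carry the law of the process
    along: equivariance enters the mass transport here. *)
Lemma reach_prob_translate a c v t : coalescing c -> 1 <= t ->
  reach_prob (translate a c) v t = reach_prob c (v + a) t.
Proof.
move=> cc t1; have cc' : coalescing (translate a c) by apply (coalescing_translate a c).
apply: (@reach_iso _ _ _ rho_closed Z (net (translate a c)) (net c)
  (fun u : even_pt => u + a) (fun u : even_pt => u - a)) => //.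
- by move=> u; rewrite addrK.
- by move=> u; rewrite subrK.
- by move=> x y; rewrite !net_dist// gd_translate.
Qed.

Variables b K : R.

(** Averaged over the process, [u] sends one unit to each good [v] that its ball covers. [maxn 1]
    discards radii below 1, which stand for no ball even at distance 0. *)
Definition transport (c : mconf) (u v : even_pt) : \bar R :=
  ((\1_(good b K v) c)%:E * reach_prob c u (maxn 1 (gd c u v))%:R)%E.

Lemma maxn1_ge n : 1 <= (maxn 1 n)%:R :> R.
Proof. by rewrite ler1n leq_maxl. Qed.

Lemma transport_ge0 c u v : (0 <= transport c u v)%E.
Proof. by rewrite mule_ge0// lee_fin. Qed.

Lemma transport_translate a c u v :
  transport (translate a c) u v = transport c (u + a) (v + a).
Proof.
rewrite /transport; have gt := good_translate b K a c v.
have [g|ng] := pselect (good b K (v + a) c); last first.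
  by rewrite !indic_propN ?mul0e// => /gt.
rewrite !indic_prop//; last by apply gt.
have cc := good_coalescing g.
by rewrite gd_translate// reach_prob_translate// maxn1_ge.
Qed.

(** Kernels are measurable at the origin and for a fixed threshold. Hence the random distance is
    split into its values [n], and a general sender [u] is moved to 0 by translation. *)
Lemma measurable_transport u v : measurable_fun setT (fun c => transport c u v).
Proof.
have H w : measurable_fun setT (fun c => transport c 0 w).
  pose G n := [set c : mconf | good b K w c /\ gd c 0%R w = n].
  have -> : (fun c => transport c 0 w) = (fun c => \esum_(n in [set: nat])
      ((\1_(G n) c)%:E * reach_prob c 0%R (maxn 1 n)%:R))%E.
    apply/funext => c; rewrite /transport.
    have [g|ng] := pselect (good b K w c); last first.
      rewrite indic_propN// mul0e esum1// => n _.
      by rewrite indic_propN ?mul0e// => -[].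
    rewrite indic_prop// (@esum_single _ _ _ (gd c 0%R w)).
    - by rewrite indic_prop.
    - by rewrite mule_ge0// lee_fin.
    - by move=> n ne; rewrite indic_propN ?mul0e// => -[_ e]; apply: ne.
  apply: measurable_esum => n; last by move=> c; rewrite mule_ge0// lee_fin.
  apply: emeasurable_funM.
    apply/measurable_EFinP; apply: measurable_indic.
    by apply: measurable_gd; [exact: measurable_good|exact: good_coalescing].
  by apply: measurable_reach_prob; exact: maxn1_ge.
have -> : (fun c => transport c u v) =
    (fun c => transport c 0 (v - u)) \o (translate u : mconf -> mconf).
  by apply/funext => c /=; rewrite transport_translate add0r subrK.
exact: (measurableT_comp (H _) (measurable_translate u)).
Qed.

Lemma measurable_transport_out :
  measurable_fun setT (fun c => \esum_(v in setT) transport c 0%R v)%E.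
Proof.
by apply: measurable_esum => v; [exact: measurable_transport|move=> c; exact: transport_ge0].
Qed.

Lemma measurable_transport_in :
  measurable_fun setT (fun c => \esum_(v in setT) transport c v 0%R)%E.
Proof.
by apply: measurable_esum => v; [exact: measurable_transport|move=> c; exact: transport_ge0].
Qed.

(** With probability 1 some ball covers the origin, and the transport into a good origin is the
    union bound for this event. *)
Lemma transport_in_ge1 c : good b K 0 c ->
  {ae ep_prob Z (net c), forall z, forall u : net c, exists v : net c,
    1 <= rho (point_mark z v) /\ dist u v <= rho (point_mark z v)} ->
  (1 <= \esum_(v in setT) transport c v 0%R)%E.
Proof.
move=> g [N [mN N0 hN]]; have cc := good_coalescing g.
pose B v : set (ep_sample Z (net c)) := reach rho (v : net c) (maxn 1 (gd c v 0%R))%:R.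
have mB v : measurable (B v).
  by apply: measurable_reach => //; exact: maxn1_ge.
have HE : ep_prob Z (net c) (~` N) = 1%E by rewrite probability_setC// N0 sube0.
have H := @measure_exists_le R _ _ _ (ep_prob Z (net c)) B mB (~` N) (measurableC mN).
rewrite -HE; apply: (le_trans (H _)).
  move=> z /= nz; have /contrapT hz : ~ ~ forall u : net c, exists v : net c,
      1 <= rho (point_mark z v) /\ dist u v <= rho (point_mark z v).
    by move=> hz; apply: nz; exact: hN.
  have [v [v1 v2]] := hz (0 : even_pt); exists v.
  rewrite /B /reach /= -[maxn _ _]/(maxn _ _) natr_max ge_max v1 /=.
  by rewrite gd_sym// -net_dist.
by apply: le_esum => v _; rewrite /transport indic_prop// mul1e.
Qed.

End Transport.

Section TransportOut.
Context (R : realType) (A : set R) (rho : R -> R).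
Hypothesis rho_closed : forall t, 1 <= t -> closed [set x | t <= rho x].
Context (Z : eprocess (marks_in A)).
Local Notation net := (drainage_network R).

(** Extends [rpow] from [radii] to arbitrary real values, those below 1 standing for no ball. *)
Definition cut_powR (a x : R) : R := if 1 <= x then x `^ a else 0.

(** For a given sample an origin of radius r sends one unit to each good point of its ball, and
    there are O(r^a) of them by [good_count_real]; it remains to average over the sample. *)
Lemma transport_out_le (a K : R) c : 0 <= a -> 0 < K ->
  ((K * 4 `^ a)^-1%:E * (\esum_(v in setT) transport rho Z (2 `^ a) K c 0%R v) <=
   \int[ep_prob Z (net c)]_z
     (cut_powR a (rho (point_mark z (origin (net c)))))%:E)%E.
Proof.
move=> a0 K0; set C := K * 4 `^ a.
have C0 : 0 < C by rewrite mulr_gt0// powR_gt0.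
pose B v : set (ep_sample Z (net c)) :=
  reach rho (origin (net c)) (maxn 1 (gd c 0%R v))%:R.
have mB v : measurable (B v).
  by apply: measurable_reach => //; exact: maxn1_ge.
pose g v z := ((\1_(good (2 `^ a) K v) c)%:E * (\1_(B v) z)%:E : \bar R)%E.
have g0 v z : (0 <= g v z)%E by rewrite mule_ge0// lee_fin.
have mI v : measurable_fun setT (fun z => (\1_(B v) z)%:E : \bar R).
  by apply/measurable_EFinP; exact: measurable_indic.
have mg v : measurable_fun setT (g v).
  by apply: emeasurable_funM => //; exact: measurable_cst.
have -> : (\esum_(v in setT) transport rho Z (2 `^ a) K c 0%R v =
   \int[ep_prob Z (net c)]_z (\esum_(v in setT) g v z))%E.
  rewrite integral_esum//; apply: eq_esum => v _.
  rewrite /g ge0_integralZl_EFin// ?lee_fin//.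
  by rewrite integral_indic// setIT.
rewrite -ge0_integralZl_EFin//; last 3 first.
- by move=> z _; apply: esum_ge0.
- exact: measurable_esum.
- by rewrite invr_ge0 ltW.
apply: ge0_le_integral_any => z.
  by apply: mule_ge0; [rewrite lee_fin invr_ge0 ltW|apply: esum_ge0].
set r := rho _.
rewrite -(@lee_pmul2l _ C%:E)// muleA -EFinM divff ?gt_eqF// mul1e.
have [r1|r1] := leP 1 r; last first.
  rewrite /cut_powR (lt_geF r1) mule0 esum1// => v _.
  rewrite /g [X in (_ * X%:E)%E]indic_propN ?mule0// /B /reach /= -/r => h.
  by have := maxn1_ge R (gd c 0%R v); lra.
rewrite /cut_powR r1 -EFinM; apply: le_trans (good_count_real c a0 K0 r1).
apply: le_esum => v _; rewrite /g.
have [gv|ng] := pselect (good (2 `^ a) K v c); last by rewrite indic_propN ?mul0e ?lee_fin.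
have [hv|nv] := pselect ((maxn 1 (gd c 0%R v))%:R <= r); last first.
  by rewrite [X in (_ * X%:E)%E]indic_propN ?mule0 ?lee_fin.
by rewrite [X in (X%:E * _)%E]indic_prop// [X in (_ * X%:E)%E]indic_prop// mul1e
  [X in (_ <= X%:E)%E]indic_prop.
Qed.

End TransportOut.

Section LowerBound.
Context (R : realType) (d : measure_display) (Omega : measurableType d)
  (P : probability Omega R) (coin : even_pt -> Omega -> bool).
Hypothesis fc : fair_coins P coin.

Let mc : measurable_fun setT (sample coin).
Proof. by apply: sample_measurable; case: fc. Qed.

Let X : {mfun Omega >-> mconf} := HB.pack (sample coin) (isMeasurableFun.Build _ _ _ _ _ mc).

Definition law : probability mconf R := distribution P X.

Lemma lawE (B : set mconf) : law B = P (sample coin @^-1` B).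
Proof. by []. Qed.

Lemma law_fair : fair_law law.
Proof.
split=> [a|s] B mB; rewrite !lawE.
  exact: (law_unique (fair_coins_translate a fc) fc mB).
exact: (law_unique (fair_coins_flip s fc) fc mB).
Qed.

Lemma integral_law (f : mconf -> \bar R) : measurable_fun setT f ->
  (forall c, 0 <= f c)%E ->
  (\int[P]_w f (sample coin w) = \int[law]_c f c)%E.
Proof.
move=> mf f0; rewrite -[RHS]/(\int[pushforward P (sample coin)]_c f c)%E.
by rewrite ge0_integral_pushforward.
Qed.

(** The expected mass received by the origin is at least the probability that it is good, hence at
    least 1/2; the expected mass sent is at most a constant times the integral on the right.
    Choosing [k] before [A], [rho] and [Z] makes it uniform in the radius of a fixed-radius
    covering. *)
Lemma lower_bound (a : R) : 3 / 2 < a -> exists2 k : R, 0 < k &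
  forall (A : set R) (rho : R -> R) (Z : eprocess (marks_in A)),
  (forall t, 1 <= t -> closed [set x | t <= rho x]) ->
  {ae P, forall w, let T := drainage_network R (sample coin w) in
    {ae ep_prob Z T, forall z, forall u : T, exists v : T,
      1 <= rho (point_mark z v) /\ dist u v <= rho (point_mark z v)}} ->
  (k%:E <= \int[P]_w let T := drainage_network R (sample coin w) in
     \int[ep_prob Z T]_z (cut_powR a (rho (point_mark z (origin T))))%:E)%E.
Proof.
move=> a32; have b2 : 2 * Num.sqrt 2 < 2 `^ a :> R.
  have -> : 2 * Num.sqrt 2 = 2 `^ (3 / 2) :> R.
    have -> : 3 / 2 = 1 + 2^-1 :> R by lra.
    by rewrite powRD ?pnatr_eq0 ?implybT// powRr1// powR12_sqrt.
  by rewrite /powR (gt_eqF (_ : 0 < 2))// ltr_expR ltr_pM2r// ln_gt0; lra.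
have [K K0 hK] := good_prob law_fair b2.
have C0 : 0 < K * 4 `^ a by rewrite mulr_gt0// powR_gt0.
exists ((K * 4 `^ a)^-1 / 2); first by rewrite divr_gt0// invr_gt0.
move=> A rho Z rho_closed cov.
pose tr := transport rho Z (2 `^ a) K.
have mto := measurable_transport_out rho_closed Z (2 `^ a) K.
have mti := measurable_transport_in rho_closed Z (2 `^ a) K.
have tr0 c u v : (0 <= tr c u v)%E by exact: transport_ge0.
have H1 : (2^-1%:E <= \int[law]_c (\esum_(v in setT) tr c 0%R v))%E.
  apply: (le_trans hK).
  have mtr u v : measurable_fun setT (fun c => tr c u v) by exact: measurable_transport.
  have EO := @integral_esum R even_pt _ _ law (fun v c => tr c 0 v) (mtr 0) (fun v c => tr0 c 0 v).
  have EI := @integral_esum R even_pt _ _ law (fun v c => tr c v 0) (fun v => mtr v 0) (fun v c => tr0 c v 0).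
  have MT := @mass_transport R law law_fair tr mtr tr0 (transport_translate rho_closed Z (2 `^ a) K).
  have LI := integral_law mti (fun c => esum_ge0 (fun v _ => tr0 c v 0)).
  rewrite [leRHS]EO [leRHS]MT -[leRHS]EI -[leRHS]LI {EO MT EI LI}.
  have mg := measurable_good (2 `^ a) K 0.
  have <- : (\int[law]_c (\1_(good (2 `^ a) K 0%R) c)%:E = law (good (2 `^ a) K 0%R))%E.
    by rewrite integral_indic// setIT.
  have mi : measurable_fun setT (fun c => (\1_(good (2 `^ a) K 0) c)%:E : \bar R).
    by apply/measurable_EFinP; exact: measurable_indic.
  rewrite -(integral_law mi); last by move=> c; rewrite lee_fin.
  apply: ae_ge0_le_integral => //.
  - exact: (measurableT_comp mi mc).
  - by move=> w _; exact: esum_ge0.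
  - exact: (measurableT_comp mti mc).
  apply: filterS cov => w cw _.
  have [g|ng] := pselect (good (2 `^ a) K 0 (sample coin w)); last first.
    by rewrite indic_propN//; exact: esum_ge0.
  by rewrite indic_prop//; exact: transport_in_ge1.
apply: (@le_trans _ _ (\int[P]_w ((K * 4 `^ a)^-1%:E *
    (\esum_(v in setT) tr (sample coin w) 0%R v)))%E).
  rewrite ge0_integralZl_EFin//.
  - rewrite (integral_law mto); last by move=> c; exact: esum_ge0.
    by rewrite EFinM; apply: lee_wpmul2l => //; rewrite lee_fin invr_ge0 ltW.
  - by move=> w _; exact: esum_ge0.
  - exact: (measurableT_comp mto mc).
  - by rewrite invr_ge0 ltW.
apply: ge0_le_integral_any => w.
  by apply: mule_ge0; [rewrite lee_fin invr_ge0 ltW|apply: esum_ge0].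
by apply: transport_out_le => //; lra.
Qed.

End LowerBound.

(** * Deterministic local coverings *)

Section Selection.
Context (R : realType).

(** Between such spaces an embedding with error below 1 preserves distances exactly on the ball
    concerned. *)
Definition integral_space (D : dspace R) := forall x y : D, exists n : nat, dist x y = n%:R.

Variables n M j : nat.

(** Stands for [has_descendant] on the tree, by [geodesic_has_descendant], in terms that make sense
    on every discrete space, where no direction is given. *)
Definition midpoint (D : dspace R) (k : nat) (v : D) := exists w1 w2,
  [/\ dist v w1 = k%:R, dist v w2 = M%:R & dist w1 w2 = (k + M)%:R].

(* On the tree, with h v the height of v: h v >= M, or n <= h v < M and h v = j
   modulo n. Whether v is selected depends on its M-ball only. *)
Definition selected (D : dspace R) (v : D) := integral_space D /\
  (midpoint M v \/ exists k : nat,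
     [/\ (n <= k < M)%N, k = j %[mod n], midpoint k v & ~ midpoint k.+1 v]).

Lemma midpoint_embed (D1 D2 : dspace R) (f : D1 -> D2) (v : D1) k : (k <= M)%N ->
  (forall x y, dist v x <= M%:R -> dist v y <= M%:R -> dist (f x) (f y) = dist x y) ->
  midpoint k v -> midpoint k (f v).
Proof.
move=> kM fd [w1 [w2 [h1 h2 h12]]]; exists (f w1), (f w2).
have v0 : dist v v <= M%:R by rewrite distxx.
have w1M : dist v w1 <= M%:R by rewrite h1 ler_nat.
have w2M : dist v w2 <= M%:R by rewrite h2.
by rewrite !fd.
Qed.

Lemma selected_equiv (D1 D2 : dspace R) (v1 : D1) (v2 : D2) :
  integral_space D1 -> integral_space D2 ->
  (forall k, (k <= M)%N -> midpoint k v1 <-> midpoint k v2) ->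
  selected v1 <-> selected v2.
Proof.
move=> i1 i2 h; split=> -[_ [m|[k [/andP[nk kM] kj m nm]]]]; split=> //.
- by left; apply/(h M (leqnn M)).
- right; exists k; split => //; first by rewrite nk.
    by apply/(h k (ltnW kM)).
  by move=> m'; apply: nm; apply/(h k.+1 kM).
- by left; apply/(h M (leqnn M)).
- right; exists k; split => //; first by rewrite nk.
    by apply/(h k (ltnW kM)).
  by move=> m'; apply: nm; apply/(h k.+1 kM).
Qed.

Lemma selected_iso (D1 D2 : dspace R) (f : D1 -> D2) (g : D2 -> D1) y :
  cancel f g -> cancel g f -> (forall x y, dist (f x) (f y) = dist x y) ->
  selected (g y) <-> selected y.
Proof.
move=> fg gf fd.
have gd x z : dist (g x) (g z) = dist x z by rewrite -fd !gf.
have H : integral_space D1 <-> integral_space D2.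
  by split=> i x z; [have [m hm] := i (g x) (g z)|have [m hm] := i (f x) (f z)];
     exists m; rewrite -hm ?gd ?fd.
have E : integral_space D1 -> integral_space D2 -> selected (g y) <-> selected y.
  move=> i1 i2; apply: selected_equiv => // k kM; split.
    by move=> m; rewrite -(gf y); apply: midpoint_embed m.
  by apply: midpoint_embed.
split=> s; have [i _] := s.
  by apply/E => //; apply/H.
by apply/E => //; apply/H.
Qed.

Lemma eps_embeds_le (X Y : pspace R) (f : X -> Y) (e e' : R) : 0 < e -> e <= e' ->
  eps_embeds e f -> eps_embeds e' f.
Proof.
move=> e0 ee [h1 h2 h3].
have B x : dist (origin X) x <= e'^-1 -> dist (origin X) x <= e^-1.
  by move=> /le_trans; apply; rewrite lef_pV2 ?posrE//; lra.
split=> // x y /B bx /B byy; first exact: h2.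
by apply: le_trans ee; exact: h3.
Qed.

Lemma pspace_dist_lt (X Y : pspace R) (e : R) : e <= 1 ->
  pspace_dist X Y < e ->
  exists2 e', 0 < e' < e & (exists f : X -> Y, eps_embeds e' f) /\
     (exists f : Y -> X, eps_embeds e' f).
Proof.
move=> e1; rewrite /pspace_dist gt_min => /orP[|]; first by move=> h; lra.
(* Nonemptiness of the set of admissible [e] is borrowed from the marked case, with constant
   marks. *)
have [e0 [e00 [[f [fe _]] [g [ge _]]]]] :=
    @eps_membeds_exist R R^o (@MSpace R R^o X (fun _ _ => 0)) (@MSpace R R^o Y (fun _ _ => 0)).
move=> /inf_lt => /(_ _)[|e' [e'0 h] e'e].
  by exists e0; split => //; split; [exists f|exists g].
by exists e' => //; rewrite e'0.
Qed.

Lemma eps_embeds_integral (X Y : pspace R) (f : X -> Y) (e : R) : e < 1 ->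
  integral_space X -> integral_space Y -> eps_embeds e f ->
  forall x y, dist (origin X) x <= e^-1 -> dist (origin X) y <= e^-1 ->
    dist (f x) (f y) = dist x y.
Proof.
move=> e1 iX iY [_ _ h] x y bx byy; have := h x y bx byy.
have [k ->] := iX x y; have [l ->] := iY (f x) (f y).
rewrite ler_norml => /andP[h1 h2]; congr (_%:R).
have h3 : l%:R < k.+1%:R :> R by rewrite -natr1; lra.
have h4 : k%:R < l.+1%:R :> R by rewrite -natr1; lra.
by move: h3 h4; rewrite !ltr_nat; lia.
Qed.

(* g o f permutes the finite ball, so some iterate of it fixes v. *)
Lemma midpoint_back (X Y : pspace R) (f : X -> Y) (g : Y -> X) (r : R) v k :
  (k <= M)%N ->
  f (origin X) = origin Y -> g (origin Y) = origin X ->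
  (forall x y, dist (origin X) x <= r -> dist (origin X) y <= r ->
    dist (f x) (f y) = dist x y) ->
  (forall x y, dist (origin Y) x <= r -> dist (origin Y) y <= r ->
    dist (g x) (g y) = dist x y) ->
  dist (origin X) v + M%:R <= r ->
  midpoint k (f v) -> midpoint k v.
Proof.
move=> kM fo go fd gd hr.
pose B x := dist (origin X) x = dist (origin X) v.
have M0 : 0 <= M%:R :> R by [].
have o0 : dist (origin X) (origin X) <= r.
  rewrite distxx; have := dist_triangle v (origin X) (origin X).
  by rewrite distxx (dist_sym v); lra.
have o0' : dist (origin Y) (origin Y) <= r by rewrite distxx -(distxx (origin X)).
have fB x : B x -> dist (origin Y) (f x) = dist (origin X) v.
  by rewrite /B => bx; rewrite -fo fd ?bx//; lra.
have gB y : dist (origin Y) y = dist (origin X) v -> B (g y).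
  by move=> hy; rewrite /B -{1}go gd ?hy//; lra.
pose h x := g (f x).
have hB x : B x -> B (h x) by move=> /fB/gB.
have hBi i x : B x -> B (iter i h x) by move=> bx; elim: i => //= i; exact: hB.
have hinj x y : B x -> B y -> h x = h y -> x = y.
  move=> bx byy /(congr1 (dist (h x))); rewrite distxx => /esym.
  rewrite /h gd ?fB//; [|lra|lra].
  by rewrite fd; [exact: dist_eq0|rewrite bx; lra|rewrite byy; lra].
(* The witnesses of a midpoint at [f x] may lie outside the image of [f]; they are pushed forward by
   [g] and then [f] instead of being pulled back. *)
have step x : B x -> midpoint k (f x) -> midpoint k (f (h x)).
  move=> bx m.
  have m' : midpoint k (h x).
    apply: midpoint_embed m => // y z hy hz; apply: gd.
      by have := dist_triangle (f x) (origin Y) y; rewrite fB//; lra.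
    by have := dist_triangle (f x) (origin Y) z; rewrite fB//; lra.
  have bh := hB _ bx.
  apply: midpoint_embed m' => // y z hy hz; apply: fd.
    by have := dist_triangle (h x) (origin X) y; rewrite bh; lra.
  by have := dist_triangle (h x) (origin X) z; rewrite bh; lra.
have Bv : B v by [].
have [p [q [pq hpq]]] : exists p q, (p < q)%N /\ iter p h v = iter q h v.
  apply: contrapT => no; apply: infinite_nat.
  have := @finite_preimage _ _ [set x | dist (origin X) x <= r] (fun i => iter i h v).
  have -> : (fun i => iter i h v) @^-1` [set x | dist (origin X) x <= r] = [set: nat].
    by apply/seteqP; split => i //= _; rewrite hBi//; lra.
  apply; last exact: dist_finite.
  move=> p q _ _ e; apply: contrapT => pq; apply: no.
  have /orP[h1|h1] : (p < q)%N || (q < p)%N by rewrite -neq_ltn; apply/eqP.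
    by exists p, q.
  by exists q, p.
have fixed : iter (q - p) h v = v.
  elim: p q pq hpq => [|p IH] q pq hpq; first by rewrite subn0 -hpq.
  case: q pq hpq => // q pq /= hpq; rewrite subSS; apply: IH => //.
  by apply: hinj hpq; exact: hBi.
move=> m.
have mi i : midpoint k (f (iter i h v)).
  by elim: i => //= i; apply: step; exact: hBi.
have [t tE] : exists t, (q - p)%N = t.+1 by exists (q - p).-1; lia.
(* The property at [f v] travels to [f] of the [t]-th iterate of [v]; one more [g] lands at iterate
   [t.+1], which is [v] again. *)
rewrite -fixed tE /=; have bt := hBi t v Bv.
apply: midpoint_embed (mi t) => // y z hy hz; apply: gd.
  by have := dist_triangle (f (iter t h v)) (origin Y) y; rewrite fB//; lra.
by have := dist_triangle (f (iter t h v)) (origin Y) z; rewrite fB//; lra.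
Qed.

Context (A : set R) (a0 a1 : marks_in A).

Definition sel_mark (D : dspace R) (x y : D) : marks_in A :=
  if pselect (selected x) then a1 else a0.

Lemma sel_mark_eq (D1 D2 : dspace R) (x : D1) (y : D1) (x' y' : D2) :
  (selected x <-> selected x') -> sel_mark x y = sel_mark x' y'.
Proof.
by move=> h; rewrite /sel_mark; case: pselect => s; case: pselect => s' //; case: (s' _) || case: (s _); apply/h.
Qed.

Definition sel_space (X : pspace R) : mspace (marks_in A) :=
  @MSpace R (marks_in A) X (@sel_mark X).

Lemma mspace_dist_le (Xi : metricType R) (X Y : mspace Xi) e : 0 < e ->
  (exists f : X -> Y, eps_membeds e f) -> (exists f : Y -> X, eps_membeds e f) ->
  mspace_dist X Y <= e.
Proof.
move=> e0 hf hg; rewrite /mspace_dist ge_min; apply/orP; right.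
apply: ge_inf; last by split.
by exists 0 => x [/ltW].
Qed.

Lemma nonintegral_mark (D : dspace R) (x y : D) : ~ integral_space D ->
  sel_mark x y = a0.
Proof. by move=> ni; rewrite /sel_mark; case: pselect => // -[]. Qed.

Lemma sel_space_continuous (X : pspace R) (e : R) : 0 < e ->
  exists2 de, 0 < de & forall Y : pspace R,
    (integral_space X <-> integral_space Y) ->
    pspace_dist X Y < de -> mspace_dist (sel_space X) (sel_space Y) <= e.
Proof.
move=> e0; pose r := e^-1 + M%:R.
have r0 : 0 < r by rewrite ltr_wpDr// invr_gt0.
have r0i : 0 < r^-1 by rewrite invr_gt0.
(* The bound 1/2 makes integer distances exact, [r^-1] extends this to radius [e^-1 + M], which
   contains the [M]-balls of the points whose marks are compared, and [e] makes the maps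
   [e]-embeddings. *)
exists (Num.min (Num.min e 2^-1) r^-1).
  by rewrite !lt_min e0 r0i invr_gt0 ltr0n.
move=> Y iXY /pspace_dist_lt[|e' /andP[e'0]].
  by rewrite !ge_min; apply/orP; left; apply/orP; right; lra.
rewrite !lt_min => /andP[/andP[e'e e'2] e'r] [[f fe] [g ge]].
have e'1 : e' < 1 by lra.
have rr : r <= e'^-1 by rewrite -[r]invrK lef_pV2 ?posrE// ltW.
have f' := eps_embeds_le e'0 (ltW e'e) fe.
have g' := eps_embeds_le e'0 (ltW e'e) ge.
have [iX|niX] := pselect (integral_space X); last first.
  have niY : ~ integral_space Y by move=> /iXY.
  apply: mspace_dist_le => //; [exists f|exists g]; split=> // x y _ _ /=.
    by rewrite !nonintegral_mark// mdistxx ltW.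
  by rewrite !nonintegral_mark// mdistxx ltW.
have iY : integral_space Y by apply/iXY.
have fd := eps_embeds_integral e'1 iX iY fe.
have gd := eps_embeds_integral e'1 iY iX ge.
have [fo _ _] := fe; have [go _ _] := ge.
have bX (Z : pspace R) (x z : Z) : dist (origin Z) x <= e^-1 ->
    dist x z <= M%:R -> dist (origin Z) z <= e'^-1.
  by move=> h1 h2; have := dist_triangle x (origin Z) z; rewrite /r in rr; lra.
have key (X1 Y1 : pspace R) (f1 : X1 -> Y1) (g1 : Y1 -> X1) :
    integral_space X1 -> integral_space Y1 ->
    f1 (origin X1) = origin Y1 -> g1 (origin Y1) = origin X1 ->
    (forall x y, dist (origin X1) x <= e'^-1 -> dist (origin X1) y <= e'^-1 ->
      dist (f1 x) (f1 y) = dist x y) ->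
    (forall x y, dist (origin Y1) x <= e'^-1 -> dist (origin Y1) y <= e'^-1 ->
      dist (g1 x) (g1 y) = dist x y) ->
    forall x y, dist (origin X1) x <= e^-1 ->
      mdist (sel_mark (f1 x) (f1 y)) (sel_mark x y) <= e.
  move=> i1 i2 f1o g1o f1d g1d x y hx.
  rewrite (@sel_mark_eq _ _ (f1 x) (f1 y) x y) ?mdistxx ?ltW//.
  apply: selected_equiv => // k kM; split.
    apply: (midpoint_back kM f1o g1o f1d g1d); rewrite /r in rr; lra.
  by apply: midpoint_embed => // z1 z2 h1 h2; apply: f1d; apply: bX hx _.
apply: mspace_dist_le => //; [exists f|exists g]; split=> // x y hx _.
  exact: (key X Y f g iX iY fo go fd gd x y hx).
exact: (key Y X g f iY iX go fo gd fd x y hx).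
Qed.

Lemma nonintegral_open (X : pspace R) : ~ integral_space X ->
  exists2 de, 0 < de & forall Y, pspace_dist X Y < de -> ~ integral_space Y.
Proof.
move=> ni; have [x [y nxy]] : exists x y : X, ~ exists k : nat, dist x y = k%:R.
  apply: contrapT => no; apply: ni => x y; apply: contrapT => h.
  by apply: no; exists x, y.
have dge0 (z w : X) : 0 <= dist z w.
  by have := dist_triangle w z z; rewrite distxx (dist_sym w); lra.
set t := dist x y in nxy; have t0 : 0 <= t by exact: dge0.
pose m := Num.truncn t; have /andP[mt tm] := truncn_itv t0.
have mt' : m%:R < t.
  by rewrite lt_neqAle mt andbT; apply/eqP => h; apply: nxy; exists m.
pose s := 1 + dist (origin X) x + dist (origin X) y.
have s0 : 0 < s by rewrite /s; have := dge0 (origin X) x; have := dge0 (origin X) y; lra.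
exists (Num.min (Num.min 1 s^-1) (Num.min (t - m%:R) (m.+1%:R - t))).
  by rewrite !lt_min ltr01 invr_gt0 s0 !subr_gt0 mt' tm.
move=> Y /pspace_dist_lt[|e' /andP[e'0]]; first by rewrite !ge_min lexx.
rewrite !lt_min => /andP[/andP[_ e's] /andP[e1 e2]] [[f [_ _ fd]] _] iY.
have ss : s <= e'^-1 by rewrite -[s]invrK lef_pV2 ?posrE ?invr_gt0// ltW.
have [l hl] := iY (f x) (f y).
have dx0 := dge0 (origin X) x; have dy0 := dge0 (origin X) y.
have bx : dist (origin X) x <= e'^-1 by apply: le_trans ss; rewrite /s; lra.
have byy : dist (origin X) y <= e'^-1 by apply: le_trans ss; rewrite /s; lra.
have := fd x y bx byy; rewrite hl.
rewrite -/t ler_norml => /andP[h1 h2].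
have h3 : l%:R < m.+1%:R :> R by lra.
have h4 : m%:R < l%:R :> R by lra.
by move: h3 h4; rewrite !ltr_nat ltnS leqNgt => /negP.
Qed.

(** Marking is continuous separately on integral spaces, a closed class, and on their open
    complement [O]; preimages of open sets are thus assembled from two pieces. *)
Lemma sel_space_measurable (B : set (mspace (marks_in A))) :
  borel_for (@mspace_dist R (marks_in A)) B ->
  borel_for (@pspace_dist R) [set X | B (sel_space X)].
Proof.
pose S := [set B : set (mspace (marks_in A)) |
  borel_for (@pspace_dist R) [set X | B (sel_space X)]].
have sb : sigma_algebra setT (borel_for (@pspace_dist R)) by exact: smallest_sigma_algebra.
have [sb0 sbD sbU] := sb.
have sbC V : borel_for (@pspace_dist R) V -> borel_for (@pspace_dist R) (~` V).
  by move=> /sbD; rewrite setTD.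
have sb2 V W : borel_for (@pspace_dist R) V -> borel_for (@pspace_dist R) W ->
    borel_for (@pspace_dist R) (V `|` W).
  by move=> bV bW; rewrite -bigcup2E; apply: sbU => -[|[|i]] //=.
suff : sigma_algebra setT S /\ open_for (@mspace_dist R (marks_in A)) `<=` S.
  by move=> hS h; exact: (h S hS).
split.
  split.
  - by rewrite /S /= (_ : [set _ | _] = set0)//; apply/seteqP; split.
  - move=> V mV; rewrite /S /= (_ : [set _ | _] = ~` [set X | V (sel_space X)]).
      exact: sbC.
    by apply/seteqP; split=> c //= [].
  - move=> V mV; rewrite /S /= (_ : [set _ | _] = \bigcup_i [set X | V i (sel_space X)]).
      exact: sbU.
    by apply/seteqP; split=> c /= [i _ ?]; exists i.
move=> U oU; rewrite /S /=.
pose O := [set X : pspace R | ~ integral_space X].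
have op V : open_for (@pspace_dist R) V -> borel_for (@pspace_dist R) V.
  by move=> oV; exact: sub_sigma_algebra.
have oO : open_for (@pspace_dist R) O.
  by move=> X /nonintegral_open[de de0 h]; exists de.
pose V := [set X : pspace R | U (sel_space X)].
have near (X : pspace R) : V X -> exists2 de, 0 < de & forall Y : pspace R,
    (integral_space X <-> integral_space Y) -> pspace_dist X Y < de -> V Y.
  move=> VX; have [e e0 he] := oU _ VX.
  have e20 : 0 < e / 2 by rewrite divr_gt0.
  have [de de0 hde] := sel_space_continuous X e20.
  exists de => // Y iXY /(hde Y iXY) h; apply: he; apply: le_lt_trans h _; lra.
(* Both [V] cut by [O] and the union of [V] and [O] are open; the second is then restricted to the
   closed complement of [O]. *)
have -> : [set X | U (sel_space X)] = (V `&` O) `|` ~` (~` (V `|` O) `|` O).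
  apply/seteqP; split=> X /=; rewrite -/(V X).
    move=> VX; have [ni|i] := pselect (O X); first by left.
    by right; case => //; apply; left.
  case=> [[]//|h]; apply: contrapT => nV; apply: h.
  by have [ni|i] := pselect (O X); [right|left; case].
apply: (sb2); first apply: op.
  move=> X [VX OX]; have [d1 d10 h1] := near X VX; have [d2 d20 h2] := oO X OX.
  exists (Num.min d1 d2); first by rewrite lt_min d10.
  move=> Y; rewrite lt_min => /andP[y1 y2]; have OY := h2 Y y2.
  by split=> //; apply: h1.
apply: (sbC); apply: (sb2); last exact: op.
apply: (sbC); apply: op => X [VX|OX]; last first.
  by have [de de0 h] := oO X OX; exists de => // Y /h; right.
have [d1 d10 h1] := near X VX.
have [OX|iX] := pselect (O X).
  by have [de de0 h] := oO X OX; exists de => // Y /h; right.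
exists d1 => // Y hY; have [OY|iY] := pselect (O Y); first by right.
left; apply: h1 => //; split=> _; exact: contrapT.
Qed.

Lemma sel_process_equivariant (D1 D2 : dspace R) (f : D1 -> D2) (g : D2 -> D1) :
  cancel f g -> cancel g f -> (forall x y, dist (f x) (f y) = dist x y) ->
  forall E : set (D2 -> D2 -> marks_in A), marking_measurable E ->
  dirac tt [set _ : unit | E (fun x y => sel_mark (g x) (g y))] =
  dirac tt [set _ : unit | E (@sel_mark D2)] :> \bar R.
Proof.
move=> fg gf fd E _.
rewrite (_ : (fun x y => sel_mark (g x) (g y)) = @sel_mark D2)//.
by apply/funext => x; apply/funext => y; apply/sel_mark_eq/(selected_iso _ fg gf fd).
Qed.

Lemma sel_process_kernel (B : set (mspace (marks_in A))) :
  borel_for (@mspace_dist R (marks_in A)) B ->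
  measurable_on_classes (fun X : pspace R =>
    dirac tt [set _ : unit | B (sel_space X)]).
Proof.
move=> /sel_space_measurable bB; set W := [set X | B (sel_space X)] in bB.
have [sb0 sbD sbU] : sigma_algebra setT (borel_for (@pspace_dist R)).
  exact: smallest_sigma_algebra.
have [f [f1 f0 fE]] : exists f : pspace R -> \bar R,
    [/\ forall X, W X -> f X = 1%E, forall X, ~ W X -> f X = 0%E &
        (fun X : pspace R => dirac tt [set _ : unit | B (sel_space X)]) = f].
  exists (fun X : pspace R => dirac tt [set _ : unit | B (sel_space X)]).
  by split=> // X w; [rewrite /dirac indicE mem_set|rewrite /dirac indicE memNset].
rewrite fE => V mV; have [v1|v1] := pselect (V 1%E); have [v0|v0] := pselect (V 0%E).
- rewrite (_ : _ @^-1` _ = setT `\` set0); first exact: sbD.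
  apply/seteqP; split=> X /= _; first by split.
  by have [w|w] := pselect (W X); [rewrite f1|rewrite f0].
- rewrite (_ : _ @^-1` _ = W)//; apply/seteqP; split=> X /=; last by move=> w; rewrite f1.
  by have [w|w] := pselect (W X); [rewrite f1|rewrite f0].
- rewrite (_ : _ @^-1` _ = setT `\` W); first exact: sbD.
  apply/seteqP; split=> X /=; last by move=> [_ w]; rewrite f0.
  by have [w|w] := pselect (W X); [rewrite f1|rewrite f0].
- rewrite (_ : _ @^-1` _ = set0)//; apply/seteqP; split=> X //=.
  by have [w|w] := pselect (W X); [rewrite f1|rewrite f0].
Qed.

Definition sel_process : eprocess (marks_in A) :=
  @EProcess R (marks_in A) (fun=> default_measure_display) (fun=> unit)
    (fun=> dirac tt) (fun D _ => @sel_mark D) (fun D E _ => I)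
    sel_process_equivariant sel_process_kernel.

End Selection.

(** * Heights and selected points on the drainage network *)

Section NetSelection.
Context (R : realType).
Local Notation net := (drainage_network R).

Lemma net_integral c : coalescing c -> integral_space (net c).
Proof. by move=> cc x y; exists (gd c x y); rewrite net_dist. Qed.

Lemma net_midpoint M k c (v : net c) : coalescing c -> (k <= M)%N ->
  midpoint M k v <-> has_descendant c k v.
Proof.
move=> cc kM; rewrite -(geodesic_has_descendant v cc kM).
split=> -[w1 [w2 [h1 h2 h12]]]; exists w1, w2; split.
- by apply/eqP; rewrite -(eqr_nat R) -net_dist//; apply/eqP.
- by apply/eqP; rewrite -(eqr_nat R) -net_dist//; apply/eqP.
- by apply/eqP; rewrite -(eqr_nat R) -net_dist//; apply/eqP.
- by rewrite net_dist// h1.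
- by rewrite net_dist// h2.
- by rewrite net_dist// h12.
Qed.

Definition height_in n M j c v := exists k : nat,
  [/\ (n <= k < M)%N, k = j %[mod n], has_descendant c k v & ~ has_descendant c k.+1 v].

Lemma net_selected n M j c (v : net c) : coalescing c ->
  selected n M j v <-> has_descendant c M v \/ height_in n M j c v.
Proof.
move=> cc; split.
  move=> [_ [/(net_midpoint v cc (leqnn M))|[k [/andP[nk kM] kj m nm]]]]; first by left.
  right; exists k; split=> //; first by rewrite nk.
    by apply/(net_midpoint v cc (ltnW kM)).
  by move=> h; apply: nm; apply/(net_midpoint v cc kM).
move=> h; split; first exact: net_integral.
case: h => [h|[k [/andP[nk kM] kj m nm]]]; first by left; apply/(net_midpoint v cc (leqnn M)).
right; exists k; split=> //; first by rewrite nk.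
  by apply/(net_midpoint v cc (ltnW kM)).
by move=> h; apply: nm; apply/(net_midpoint v cc kM).
Qed.

Lemma has_descendant_leq c v k l : (k <= l)%N -> has_descendant c l v -> has_descendant c k v.
Proof.
by move=> kl [w hw]; exists (flow c (l - k) w); rewrite -flowD subnKC.
Qed.

(* Going 2n steps down from u leads to a point v0 of height h >= 2n. The deepest
   line of descendants of v0 passes through every height below h, in particular
   through the last one before h in the residue class of j. *)
Lemma net_covering n M j c (u : net c) : (0 < n)%N -> (j < n)%N -> coalescing c ->
  exists v : net c, selected n M j v /\ dist u v <= (3 * n)%:R.
Proof.
move=> n0 jn cc; pose v0 := flow c (2 * n) u.
have d0 : gd c u v0 = (2 * n)%N by rewrite gd_flow.
have [hM|nM] := pselect (has_descendant c M v0).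
  exists v0; split; first by apply/net_selected => //; left.
  by rewrite net_dist// d0 ler_nat; lia.
have [k0 [hk0 nk0]] : exists k0, has_descendant c k0 v0 /\ ~ has_descendant c k0.+1 v0.
  apply: contrapT => no; apply: nM; elim: M => [|k IH]; first by exists v0.
  by apply: contrapT => nk; apply: no; exists k.
have nk : (2 * n <= k0)%N.
  rewrite leqNgt; apply/negP => k0n; apply: nk0.
  by apply: (has_descendant_leq k0n); exists u.
have kM : (k0 < M)%N.
  by rewrite ltnNge; apply/negP => Mk; apply: nM; exact: has_descendant_leq hk0.
have [w hw] := hk0.
pose k := (j + (k0 - j) %/ n * n)%N.
(* Rounding [k0] down to the residue class loses less than [n]; from [2 * n <= k0] this leaves
   [n <= k] and a total distance below [3 * n]. *)
have hk : (k <= k0 < k + n)%N.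
  have := divn_eq (k0 - j) n; have := ltn_pmod (k0 - j) n0; rewrite /k; lia.
exists (flow c k w); split.
  apply/net_selected => //; right; exists k; split.
  - by lia.
  - by rewrite /k addnC modnMDl.
  - by exists w.
  - move=> [x hx]; apply: nk0; exists x.
    have -> : k0.+1 = (k0 - k + k.+1)%N by lia.
    by rewrite flowD hx -flowD subnK//; lia.
rewrite net_dist// ler_nat.
have := gd_triangle v0 u (flow c k w) cc; rewrite d0 gd_sym// [gd c v0 _]gd_sym//.
have -> : v0 = flow c (k0 - k) (flow c k w) by rewrite -flowD subnK ?hw//; lia.
by rewrite gd_flow//; lia.
Qed.

Section Probability.
Context (mu : probability mconf R).
Hypothesis fl : fair_law mu.

Lemma measurable_height_in n M j v :
  measurable ([set c | height_in n M j c v] : set mconf).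
Proof.
apply: measurable_exists => k.
rewrite (_ : (fun _ => _) = [set c : mconf | (n <= k < M)%N /\ k = j %[mod n]] `&`
  ([set c : mconf | has_descendant c k v] `&` ~` [set c : mconf | has_descendant c k.+1 v])).
  apply: measurableI; first exact: measurable_prop.
  by apply: measurableI; [|apply: measurableC]; exact: measurable_has_descendant.
by apply/seteqP; split=> c /=; [case|move=> [[? ?] [? ?]]].
Qed.

(** A point has at most one height, so the [n] residue classes give disjoint events, all inside the
    event of having an [n]-th generation descendant; one of them has at most the average
    probability. *)
Lemma mu_height_in n M : (0 < n)%N -> exists2 j, (j < n)%N &
  (mu [set c | height_in n M j c 0%R] <= (survival R n 1 / n%:R)%:E)%E.
Proof.
move=> n0; pose F (j : 'I_n) := [set c : mconf | height_in n M j c 0%R].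
have mF j : measurable (F j) by exact: measurable_height_in.
have tF : trivIset setT F.
  move=> i j _ _ [c [[k [_ ki h1 nh1]] [l [_ lj h2 nh2]]]].
  have kl : k = l.
    apply/eqP; rewrite eqn_leq; apply/andP; split; rewrite leqNgt; apply/negP => h.
      by apply: nh2; exact: has_descendant_leq h1.
    by apply: nh1; exact: has_descendant_leq h2.
  by apply: val_inj => /=; rewrite -(modn_small (ltn_ord i)) -(modn_small (ltn_ord j)) -ki -lj kl.
have sF : (\sum_(j < n) mu (F j) <= (survival R n 1)%:E)%E.
  have <- := measure_bigsetU_ord mu xpredT mF tF.
  apply: le_trans (mu_has_descendant fl n); rewrite le_measure ?inE//.
  - by apply: bigsetU_measurable => j _; exact: mF.
  - exact: measurable_has_descendant.
  apply: (big_ind (fun S : set mconf => S `<=` _)) => //.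
    by move=> S1 S2 h1 h2 c [/h1|/h2].
  move=> j _ c [k [/andP[nk _] _ h _]]; exact: has_descendant_leq h.
apply: contrapT => no.
have lt j : ((survival R n 1 / n%:R)%:E < mu (F j))%E.
  by rewrite ltNge; apply/negP => h; apply: no; exists j.
have fF j : mu (F j) = (fine (mu (F j)))%:E by rewrite fineK// fin_num_measure.
move: sF; under eq_bigr do rewrite fF.
rewrite sumEFin lee_fin leNgt => /negP; apply.
have -> : survival R n 1 = \sum_(j < n) (survival R n 1 / n%:R).
  by rewrite sumr_const card_ord -[RHS]mulr_natr divfK// pnatr_eq0 -lt0n.
apply: ltr_sum; first by apply/hasP; exists (Ordinal n0); rewrite ?mem_index_enum.
by move=> j _; have := lt j; rewrite fF lte_fin.
Qed.

Lemma mu_selected_le n : (0 < n)%N -> exists M, exists2 j, (j < n)%N &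
  (mu ([set c | has_descendant c M 0%R] `|` [set c | height_in n M j c 0%R])
    <= (4 / (n%:R * Num.sqrt n%:R))%:E)%E.
Proof.
(* At generation n^3 the survival probability is at most 2 / n^(3/2), the same bound as for the
   residue class, so the cutoff does not change the order. *)
move=> n0; pose M := (n ^ 3)%N; exists M.
have [j jn hj] := mu_height_in M n0; exists j => //.
apply: le_trans (measureU2 _ _ _) _.
- exact: measurable_has_descendant.
- exact: measurable_height_in.
apply: (@le_trans _ _ ((survival R M 1)%:E + (survival R n 1 / n%:R)%:E)%E).
  by apply: leeD => //; exact: mu_has_descendant.
have n1 : 0 < n%:R :> R by rewrite ltr0n.
have sn0 : 0 < Num.sqrt n%:R :> R by rewrite sqrtr_gt0.
have sE : Num.sqrt n%:R ^+ 2 = n%:R :> R by rewrite sqr_sqrtr// ltW.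
have H1 : survival R M 1 <= 2 / (n%:R * Num.sqrt n%:R).
  apply: (le_trans (survival1_le R M)).
  rewrite ler_pM2l// lef_pV2 ?posrE ?sqrtr_gt0 ?mulr_gt0//.
  rewrite -(@ler_pXn2r _ 2)// ?nnegrE ?sqrtr_ge0 ?mulr_ge0 ?ltW//.
  by rewrite exprMn sE sqr_sqrtr// -natrX -natrM ltr_nat /M (expnSr n 2).
have H2 : survival R n 1 / n%:R <= 2 / (n%:R * Num.sqrt n%:R).
  rewrite invfM mulrA mulrAC ler_pM2r ?invr_gt0//.
  apply: (le_trans (survival1_le R n)); rewrite ler_pM2l//.
  by rewrite lef_pV2 ?posrE ?sqrtr_gt0// ler_sqrt// ler_nat.
by rewrite -EFinD lee_fin; move: H1 H2; lra.
Qed.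

End Probability.

Lemma point_mark_sel n M j (A : set R) (a0 a1 : marks_in A) (D : dspace R) z (v : D) :
  point_mark (P := sel_process n M j a0 a1) z v =
  if pselect (selected n M j v) then val a1 else val a0.
Proof. by rewrite /point_mark /= /sel_mark; case: pselect. Qed.

(** The kernel of [sel_process] is deterministic: the probability that the mark of the origin is at
    least 1 is the indicator of this set. *)
Lemma measurable_selected n M j :
  measurable ([set c | selected n M j (origin (net c))] : set mconf).
Proof.
have i0 : (0 : R) \in [set 0; 1 : R] by rewrite inE; left.
have i1 : (1 : R) \in [set 0; 1 : R] by rewrite inE; right.
pose a0 : marks01 R := exist _ 0 i0; pose a1 : marks01 R := exist _ 1 i1.
have cl (t : R) : 1 <= t -> closed [set x : R | t <= x] by move=> _; exact: closed_ge.
have := measurable_reach_prob cl (sel_process n M j a0 a1) (lexx 1).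
move=> /(_ measurableT)/(_ _ (emeasurable_set1 1%E)); rewrite setTI.
congr measurable; apply/seteqP; split=> c /=.
  rewrite /reach_prob /= => h; apply: contrapT => ns; move: h.
  rewrite /dirac indic_propN; first by case=> /eqP; rewrite eq_sym oner_eq0.
  by rewrite /reach /= point_mark_sel; case: pselect => //= _; lra.
move=> s; rewrite /reach_prob /= /dirac indic_prop//.
by rewrite /reach /= point_mark_sel; case: pselect.
Qed.

End NetSelection.

(** * Bounds for the covering intensity and the Hausdorff content *)

Section Bounds.
Context (R : realType) (d : measure_display) (Omega : measurableType d)
  (P : probability Omega R) (coin : even_pt -> Omega -> bool).
Hypothesis fc : fair_coins P coin.

Let T (w : Omega) : pspace R := drainage_network R (sample coin w).

Let mc : measurable_fun setT (sample coin).
Proof. by apply: sample_measurable; case: fc. Qed.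

Lemma measurable_sample_preimage (B : set mconf) : measurable B ->
  measurable [set w | B (sample coin w)].
Proof. by move=> mB; rewrite -[X in measurable X]setTI; exact: mc. Qed.

Lemma ae_coalescing : {ae P, forall w, coalescing (sample coin w)}.
Proof.
exists [set w | (~` coalescing) (sample coin w)]; split => //.
- by apply: measurable_sample_preimage; apply: measurableC; exact: measurable_coalescing.
- exact: (mu_coalescing (law_fair fc)).
Qed.

Lemma selected_prob_le n : (0 < n)%N -> exists M, exists2 j, (j < n)%N &
  (P [set w | selected n M j (origin (T w))] <= (4 / (n%:R * Num.sqrt n%:R))%:E)%E.
Proof.
move=> n0; have [M [j jn h]] := mu_selected_le (law_fair fc) n0.
exists M, j => //; apply: le_trans h.
pose E : set mconf := [set c | has_descendant c M 0%R] `|` [set c | height_in n M j c 0%R].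
have mE : measurable E.
  by apply: measurableU; [exact: measurable_has_descendant|exact: measurable_height_in].
have mS := measurable_selected R n M j.
have mC := measurable_coalescing.
have H : (law fc [set c | selected n M j (origin (drainage_network R c))] <=
    law fc (E `|` ~` coalescing))%E.
  rewrite le_measure ?inE//; first by apply: measurableU => //; exact: measurableC.
  move=> c /= s; have [cc|cc] := pselect (coalescing c); last by right.
  by left; move/(net_selected n M j (origin (drainage_network R c)) cc): s.
apply: (le_trans H); apply: le_trans (measureU2 _ _ _) _ => //; first exact: measurableC.
by rewrite [X in (_ + X)%E](mu_coalescing (law_fair fc)) adde0.
Qed.

Lemma measurable_sample_selected n M j :
  measurable [set w | selected n M j (origin (T w))].
Proof. exact: (measurable_sample_preimage (measurable_selected R n M j)). Qed.

Lemma lambda_le n (r : R) : (0 < n)%N -> (3 * n)%:R <= r ->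
  (lambda P T r <= (4 / (n%:R * Num.sqrt n%:R))%:E)%E.
Proof.
move=> n0 nr; have [M [j jn h]] := selected_prob_le n0.
have i0 : (0 : R) \in [set 0; 1 : R] by rewrite inE; left.
have i1 : (1 : R) \in [set 0; 1 : R] by rewrite inE; right.
pose S := sel_process n M j (exist _ 0 i0 : marks01 R) (exist _ 1 i1 : marks01 R).
apply: le_trans h; apply: ereal_inf_lbound; exists S; split.
  apply: filterS ae_coalescing => w cw; apply: aeW => z u.
  have [v [sv dv]] := @net_covering R n M j _ u n0 jn cw.
  exists v; first by rewrite point_mark_sel; case: pselect.
  split; last exact: le_trans nr.
  by rewrite gt_eqF// (lt_le_trans _ nr)// ltr0n muln_gt0.
have mS := measurable_sample_selected n M j.
rewrite /intensity -[RHS](_ : (\int[P]_w (\1_[set w | selected n M j (origin (T w))] w)%:E = _)%E).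
  by rewrite integral_indic// setIT.
apply: eq_integral => w _ /=; rewrite /dirac; congr (_%:E).
have [s|s] := pselect (selected n M j (origin (T w))).
  by rewrite !indic_prop//= point_mark_sel; case: pselect.
rewrite !indic_propN//= point_mark_sel; case: pselect => //= _ /eqP.
by rewrite eq_sym oner_eq0.
Qed.

Lemma H1_ge0 a : (0 <= H1 P T a)%E.
Proof.
apply: le_ereal_inf_tmp => _ [C [_ ->]]; apply: integral_ge0 => w _.
apply: integral_ge0 => z _; rewrite lee_fin /rpow.
by case: ifP => // _; exact: powR_ge0.
Qed.

Lemma H1_le n a : (0 < n)%N -> 
  (H1 P T a <= ((3 * n)%:R `^ a * (4 / (n%:R * Num.sqrt n%:R)))%:E)%E.
Proof.
move=> n0; have [M [j jn h]] := selected_prob_le n0.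
have r1 : 1 <= (3 * n)%:R :> R by rewrite ler1n muln_gt0.
have i0 : (0 : R) \in [set 0 : R] `|` [set r : R | 1 <= r] by rewrite inE; left.
have i1 : (3 * n)%:R \in [set 0 : R] `|` [set r : R | 1 <= r] by rewrite inE; right.
pose S := sel_process n M j (exist _ 0 i0 : radii R) (exist _ (3 * n)%:R i1 : radii R).
have n30 : (3 * n)%:R != 0 :> R by rewrite pnatr_eq0; lia.
have mS := measurable_sample_selected n M j.
apply: (@le_trans _ _ (\int[P]_w (((3 * n)%:R `^ a)%:E *
    (\1_[set w | selected n M j (origin (T w))] w)%:E))%E); last first.
  rewrite ge0_integralZl_EFin//.
  - rewrite integral_indic// setIT EFinM; exact: lee_wpmul2l.
  - by apply/measurable_EFinP; exact: measurable_indic.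
apply: ereal_inf_lbound; exists S; split.
  apply: filterS ae_coalescing => w cw; apply: aeW => z u.
  have [v [sv dv]] := @net_covering R n M j _ u n0 jn cw.
  exists v; rewrite point_mark_sel; case: pselect => //= _; split.
apply: eq_integral => w _.
rewrite [RHS](_ : _ = \int[dirac tt]_(z in [set: unit])
  (rpow (point_mark (P := S) (z : ep_sample S (T w)) (origin (T w))) a)%:E)%E//.
rewrite integral_dirac// diracT mul1e point_mark_sel.
have [s|s] := pselect (selected n M j (origin (T w))).
  rewrite indic_prop// mule1; case: pselect => [s'|s']; last by case: (s' s).
  by transitivity (rpow ((3 * n)%:R : R) a)%:E => //; rewrite /rpow (negbTE n30).
rewrite indic_propN// mule0; case: pselect => [s'|s']; first by case: (s s').
by transitivity (rpow (0 : R) a)%:E => //; rewrite /rpow eqxx.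
Qed.

Lemma lambda_ge (a k : R) : 0 < a ->
  (forall (A : set R) (rho : R -> R) (Z : eprocess (marks_in A)),
  (forall t, 1 <= t -> closed [set x | t <= rho x]) ->
  {ae P, forall w, let X := drainage_network R (sample coin w) in
    {ae ep_prob Z X, forall z, forall u : X, exists v : X,
      1 <= rho (point_mark z v) /\ dist u v <= rho (point_mark z v)}} ->
  (k%:E <= \int[P]_w let X := drainage_network R (sample coin w) in
     \int[ep_prob Z X]_z (cut_powR a (rho (point_mark z (origin X))))%:E)%E) ->
  forall r, 1 <= r -> ((k / r `^ a)%:E <= lambda P T r)%E.
Proof.
move=> a0 hk r r1; apply: le_ereal_inf_tmp => _ [S [cov ->]].
(* Points of the subset get radius [r], the others no ball, so the expected [a]-th power of the
   radius is r^a times the intensity. *)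
pose rho (x : R) : R := if x == 1 then r else 0.
have rho1 (t : R) : 1 <= t -> closed [set x | t <= rho x].
  move=> t1; have [tr|rt] := leP t r.
    rewrite (_ : [set _ | _] = [set x | x = 1]); first exact: closed_eq.
    apply/seteqP; split=> x /=; rewrite /rho; first by case: eqP => // _; lra.
    by move=> ->; rewrite eqxx.
  rewrite (_ : [set _ | _] = set0); first exact: closed0.
  by apply/seteqP; split=> x //=; rewrite /rho; case: eqP => _; lra.
have mI w : measurable [set z : ep_sample S (T w) | point_mark z (origin (T w)) = 1].
  have := measurable_reach rho1 S (origin (T w)) (lexx 1).
  congr measurable; apply/seteqP; split=> z; rewrite /reach /= /rho.
    by case: eqP => //; lra.
  by move=> ->; rewrite eqxx.
have := hk _ rho S rho1.
have E w : (\int[ep_prob S (T w)]_z (cut_powR a (rho (point_mark z (origin (T w)))))%:E =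
    (r `^ a)%:E * ep_prob S (T w) [set z | point_mark z (origin (T w)) = 1%R])%E.
  have <- : (\int[ep_prob S (T w)]_z (\1_[set z | point_mark z (origin (T w)) = 1] z)%:E =
      ep_prob S (T w) [set z | point_mark z (origin (T w)) = 1%R])%E.
    by rewrite integral_indic// setIT.
  rewrite -ge0_integralZl_EFin//; last 2 first.
  - by apply/measurable_EFinP; exact: measurable_indic.
  - exact: powR_ge0.
  apply: eq_integral => z _.
  have [m|m] := pselect (point_mark z (origin (T w)) = 1).
    by rewrite indic_prop// mule1 /cut_powR /rho m eqxx r1.
  by rewrite indic_propN// mule0 /cut_powR /rho; move/eqP/negbTE: m => ->; rewrite ler10.
have ra0 : 0 < r `^ a by rewrite powR_gt0; lra.
have EI : (\int[P]_w \int[ep_prob S (T w)]_z (cut_powR a (rho (point_mark z (origin (T w)))))%:E =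
   (r `^ a)%:E * intensity P T S)%E.
  rewrite -ge0_integralZl_EFin//; last 2 first.
  - have mr := measurable_reach_prob rho1 S (lexx 1).
    have := measurableT_comp mr mc; congr (measurable_fun _ _); apply/funext => w /=.
    rewrite /reach_prob; congr (ep_prob _ _ _); apply/seteqP; split=> z; rewrite /reach /= /rho.
      by case: eqP => //; lra.
    by move=> ->; rewrite eqxx.
  - exact: ltW.
  by apply: eq_integral => w _; exact: E.
have covr : {ae P, forall w, let X := drainage_network R (sample coin w) in
    {ae ep_prob S X, forall z, forall u : X, exists v : X,
      1 <= rho (point_mark z v) /\ dist u v <= rho (point_mark z v)}}.
  apply: filterS cov => w; apply: filterS => z hz u.
  have [v mv [_ dv]] := hz u; exists v.
  by rewrite mv /rho eqxx.
move=> /(_ covr); rewrite /= [X in (_ <= X)%E]EI => h.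
rewrite -(@lee_pmul2l _ (r `^ a)%:E)//; apply: le_trans h.
by rewrite -EFinM mulrC divfK// gt_eqF.
Qed.

End Bounds.

(** * The dimensions *)

Section Dimension.
Context (R : realType) (d : measure_display) (Omega : measurableType d)
  (P : probability Omega R) (coin : even_pt -> Omega -> bool).
Hypothesis fc : fair_coins P coin.

Let T (w : Omega) : pspace R := drainage_network R (sample coin w).

Lemma mul_sqrt_powR (x : R) : 0 <= x -> x * Num.sqrt x = x `^ (3 / 2).
Proof.
rewrite le_eqVlt => /predU1P[<-|x0].
  by rewrite mul0r powR0// mulf_neq0 ?invr_neq0.
have -> : 3 / 2 = 1 + 2^-1 :> R by lra.
by rewrite powRD ?(gt_eqF x0) ?implybT// powRr1 ?ltW// powR12_sqrt// ltW.
Qed.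

Lemma H1_eq0 a : 0 <= a -> a < 3 / 2 -> H1 P T a = 0%E.
Proof.
move=> a0 a32; apply/eqP; rewrite eq_le (H1_ge0 P coin a) andbT.
apply/lee_addgt0Pr => e e0; rewrite add0e.
pose dl := 3 / 2 - a; have dl0 : 0 < dl by rewrite subr_gt0.
pose C : R := 4 * 3 `^ a; have C0 : 0 < C by rewrite mulr_gt0// powR_gt0.
(* The bound of [H1_le] equals [C / n ^ dl]; this [n] makes it at most [e]. *)
pose n := (Num.bound ((C / e) `^ dl^-1)).
have hn : (C / e) `^ dl^-1 < n%:R by rewrite archi_boundP// powR_ge0.
have nR : 0 < n%:R :> R by apply: le_lt_trans hn; exact: powR_ge0.
have n0 : (0 < n)%N by rewrite ltr0n in nR.
apply: le_trans (H1_le fc a n0) _; rewrite lee_fin mul_sqrt_powR//.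
rewrite natrM powRM//.
have -> : n%:R `^ (3 / 2) = n%:R `^ a * n%:R `^ dl :> R.
  have <- : a + dl = 3 / 2 by rewrite /dl; lra.
  by rewrite powRD// (gt_eqF nR) implybT.
have na0 : 0 < n%:R `^ a :> R by rewrite powR_gt0.
have nd0 : 0 < n%:R `^ dl :> R by rewrite powR_gt0.
have -> : 3 `^ a * n%:R `^ a * (4 / (n%:R `^ a * n%:R `^ dl)) = C / n%:R `^ dl.
  by rewrite /C; field; rewrite !gt_eqF.
rewrite ler_pdivrMr// mulrC -ler_pdivrMr//.
have -> : C / e = ((C / e) `^ dl^-1) `^ dl.
  by rewrite -powRrM mulVf ?gt_eqF// powRr1// divr_ge0// ltW.
by apply: ge0_ler_powR; rewrite ?nnegrE ?powR_ge0// ltW.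
Qed.

Lemma cut_powR_radius a (C : eprocess (radii R)) w (z : ep_sample C (T w)) (v : T w) :
  rpow (point_mark z v) a = cut_powR a (point_mark z v).
Proof.
have := valP (ep_val z v v); rewrite inE /= -/(point_mark z v) => -[m0|m1].
  by rewrite /cut_powR /rpow m0 eqxx ler10.
by rewrite /cut_powR /rpow m1 gt_eqF// (lt_le_trans ltr01).
Qed.

Lemma H1_gt0 a : 3 / 2 < a -> (0 < H1 P T a)%E.
Proof.
move=> a32; have [k k0 hk] := lower_bound fc a32.
apply: (@lt_le_trans _ _ k%:E); first by rewrite lte_fin.
apply: le_ereal_inf_tmp => _ [C [cov ->]].
have := hk _ (fun x => x) C (fun t _ => @closed_ge _ t).
have covr : {ae P, forall w, let X := drainage_network R (sample coin w) in
    {ae ep_prob C X, forall z, forall u : X, exists v : X,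
      1 <= point_mark z v /\ dist u v <= point_mark z v}}.
  apply: filterS cov => w; apply: filterS => z hz u.
  have [v [mv dv]] := hz u; exists v; split=> //.
  by have := valP (ep_val z v v); rewrite inE /= -/(point_mark z v) => -[m0|//]; rewrite m0 eqxx in mv.
move=> /(_ covr) /le_trans; apply; rewrite le_eqVlt; apply/orP; left; apply/eqP.
apply: eq_integral => w _; apply: eq_integral => z _.
by rewrite cut_powR_radius.
Qed.

Lemma udimH_drainage : udimH P T = (3 / 2)%:E.
Proof.
rewrite /udimH; set S := [set a%:E | a in _].
have ub : ubound S (3 / 2)%:E.
  move=> _ [a [a0 h] <-]; rewrite lee_fin leNgt; apply/negP => /H1_gt0.
  by rewrite h ltxx.
have h1 : (ereal_sup S <= (3 / 2)%:E)%E by exact: ge_ereal_sup.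
have h2 : ((3 / 2)%:E <= ereal_sup S)%E.
  (* The minimum with 1 keeps [a] nonnegative. *)
  apply/lee_addgt0Pr => e e0; pose a := 3 / 2 - Num.min e 1 : R.
  have m0 : 0 < Num.min e 1 by rewrite lt_min e0 ltr01.
  have m1 : Num.min e 1 <= 1 by rewrite ge_min lexx orbT.
  have me : Num.min e 1 <= e by rewrite ge_min lexx.
  have Sa : S a%:E.
    by exists a => //; split; [|apply: H1_eq0]; rewrite /a; lra.
  apply: (@le_trans _ _ (a%:E + e%:E)%E).
    by rewrite -EFinD lee_fin /a; lra.
  by apply: leeD => //; exact: ereal_sup_ubound.
apply/eqP; rewrite eq_le ge_max h1 lee_fin; apply/andP; split; first by lra.
by rewrite le_max h2 orbT.
Qed.

Lemma lambda_upper r : 3 <= r -> (lambda P T r <= (4 * 6 `^ (3 / 2) / r `^ (3 / 2))%:E)%E.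
Proof.
move=> r3; pose n := Num.truncn (r / 3).
have r0 : 0 <= r / 3 by lra.
have /andP[n1 n2] := truncn_itv r0; rewrite -/n in n1 n2.
have n0 : (0 < n)%N by rewrite truncn_gt0; lra.
have nR : 1 <= n%:R :> R by rewrite ler1n.
apply: le_trans (lambda_le fc n0 (r := r) _) _.
  by rewrite natrM; lra.
rewrite lee_fin mul_sqrt_powR// -mulrA ler_pM2l//.
(* As [1 <= n], one has r/3 < n + 1 <= 2n: truncation costs at most a factor 2. *)
have n60 : r / 6 <= n%:R by move: n2; rewrite -(natr1 n); lra.
have h : (r / 6) `^ (3 / 2) <= n%:R `^ (3 / 2).
  by apply: ge0_ler_powR; rewrite ?nnegrE//; lra.
have p0 : 0 < (r / 6) `^ (3 / 2) by rewrite powR_gt0; lra.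
have -> : 6 `^ (3 / 2) / r `^ (3 / 2) = ((r / 6) `^ (3 / 2))^-1.
  have rE : r = (r / 6) * 6 by lra.
  have q0 : 0 < 6 `^ (3 / 2) :> R by rewrite powR_gt0.
  rewrite {1}rE powRM//; last by lra.
  by field; rewrite !gt_eqF.
by rewrite lef_pV2 ?posrE// (lt_le_trans p0).
Qed.

Lemma lambda_lower a : 3 / 2 < a -> exists2 k, 0 < k &
  forall r, 1 <= r -> ((k / r `^ a)%:E <= lambda P T r)%E.
Proof.
move=> a32; have [k k0 hk] := lower_bound fc a32; exists k => //.
by apply: (lambda_ge fc _ hk); lra.
Qed.

Lemma udimM_drainage : is_udimM P T (3 / 2)%:E.
Proof.
(* Any exponent above 3/2 would do: this only shows that [lambda] is positive, so that its logarithm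
   is real. *)
have [k1 k10 hk1] : exists2 k, 0 < k & forall r, 1 <= r -> ((k / r `^ 2)%:E <= lambda P T r)%E.
  by apply: lambda_lower; lra.
pose C : R := 4 * 6 `^ (3 / 2).
have C0 : 0 < C by rewrite mulr_gt0// powR_gt0.
have fin r : 3 <= r -> lambda P T r = (fine (lambda P T r))%:E /\ 0 < fine (lambda P T r).
  move=> r3; have h1 := lambda_upper r3.
  have h2 := hk1 r (le_trans (ler_nat R 1 3) r3).
  have p : 0 < k1 / r `^ 2 by rewrite divr_gt0// powR_gt0; lra.
  case: (lambda P T r) h1 h2 => [x| |]//; rewrite !lee_fin /= => _ h.
  by split=> //; exact: lt_le_trans h.
have val r : 3 <= r -> (- lne (lambda P T r) / (ln r)%:E)%E =
    (- ln (fine (lambda P T r)) / ln r)%:E.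
  move=> r3; have [e p] := fin r r3; rewrite e /= leNgt p /= inver gt_eqF.
    by rewrite EFinM.
  by apply: ln_gt0; lra.
rewrite /is_udimM; apply/fine_cvgP; split.
  near=> r; rewrite val//; near: r; exact: nbhs_pinfty_ge.
apply/cvgrPdist_le => e e0.
(* Half of [e] goes into the exponent; the other half absorbs [ln k] once [r] passes the threshold
   [rk] below. *)
have [k k0 hk] : exists2 k, 0 < k & forall r, 1 <= r -> ((k / r `^ (3 / 2 + e / 2))%:E <= lambda P T r)%E.
  by apply: lambda_lower; lra.
near=> r.
have r3 : 3 <= r by near: r; exact: nbhs_pinfty_ge.
have rC : expR (`|ln C| / e) <= r by near: r; exact: nbhs_pinfty_ge.
have rk : expR (`|ln k| / (e / 2)) <= r by near: r; exact: nbhs_pinfty_ge.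
have r0 : 0 < r by lra.
have ln0 : 0 < ln r by apply: ln_gt0; lra.
have lC : `|ln C| <= e * ln r.
  rewrite mulrC -ler_pdivrMr//; rewrite -(expRK (_ / _)).
  by rewrite ler_ln ?posrE ?expR_gt0.
have lk : `|ln k| <= e / 2 * ln r.
  rewrite mulrC -ler_pdivrMr ?divr_gt0//; rewrite -(expRK (_ / (e / 2))).
  by rewrite ler_ln ?posrE ?expR_gt0.
have [fE fp] := fin r r3.
have := lambda_upper r3; have := hk r (le_trans (ler_nat R 1 3) r3).
rewrite /= val//= fE !lee_fin; set l := fine _ in fE fp *.
have pk : 0 < r `^ (3 / 2 + e / 2) by rewrite powR_gt0.
have p32 : 0 < r `^ (3 / 2) by rewrite powR_gt0.
move=> h1 h2.
have : ln (k / r `^ (3 / 2 + e / 2)) <= ln l by rewrite ler_ln ?posrE ?divr_gt0.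
rewrite ln_div ?posrE// ln_powR => g1.
have : ln l <= ln (C / r `^ (3 / 2)) by rewrite ler_ln ?posrE ?divr_gt0.
rewrite ln_div ?posrE// ln_powR => g2.
rewrite ler_norml; move: lC lk; rewrite !ler_norml => /andP[c1 c2] /andP[d1 d2].
have -> : 3 / 2 - - ln l / ln r = (3 / 2 * ln r + ln l) / ln r by field; rewrite gt_eqF.
by rewrite ler_pdivlMr// ler_pdivrMr//; apply/andP; split; lra.
Unshelve. all: by end_near.
Qed.

End Dimension.

End Drainage.

Theorem proposition4p14 (R : realType) (d : measure_display)
    (Omega : measurableType d) (P : probability Omega R)
    (coin : even_pt -> Omega -> bool)
    (coin_measurable : forall u, measurable_fun setT (coin u))
    (coin_fair : forall u, P [set w | coin u w = true] = (2^-1)%:E)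
    (coin_independent : mutually_independent P coin) :
  let T := fun w : Omega => drainage_network R (fun u => coin u w) in
  is_udimM P T (3 / 2)%:E /\ udimH P T = (3 / 2)%:E.
Proof.
have fc : Drainage.fair_coins P coin by split.
by split; [exact: (Drainage.udimM_drainage fc)|exact: (Drainage.udimH_drainage fc)].
Qed.
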